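(* Let $k$ be a field with $\operatorname{char}(k)\neq2,3$, let $c\in k^*$, $\Delta=-c/27$, and assume $\sqrt\Delta\in k$. Let $\mathcal E$ be the elliptic curve $Y^2=X^3+c$, $\mathcal T=\{\mathcal O,(0,\sqrt c),(0,-\sqrt c)\}\subseteq\mathcal E(k_s)$, and $\Psi:H^1(k,\mathcal T)\to H^1(k,\mathcal E)$ the map induced by inclusion. For any $t\in k^*\setminus k^{*3}$, the curve $\mathcal C_t$ corresponding to $\Psi[\gamma_t]\in H^1(k,\mathcal E)$ is the projective curve $$\mathcal C_t:\ X^3-tY^3=-54\sqrt\Delta\,t^2Z^3 .$$
   Context: $k_s$ is a separable closure of $k$, $G_k=\operatorname{Gal}(k_s/k)$. $\mathcal E$ is the projective elliptic curve with point at infinity $\mathcal O$ as identity; $(0,\sqrt c)$ has order 3. $H^1(k,\mathcal E)=H^1(G_k,\mathcal E(k_s))$ classifies principal homogeneous spaces of $\mathcal E$ over $k$; ''the curve corresponding to'' a class is the underlying smooth projective curve, determined up to $k$-isomorphism. Fix $\sqrt c\in k_s$ and a primitive cube root of unity $\omega\in k_s$, and fix the choice of $\sqrt\Delta$ so that $\sqrt c=3(2\omega+1)\sqrt\Delta$. Put $P=(0,\sqrt c)$; since $\sqrt\Delta\in k$, $P\mapsto\omega$ gives an isomorphism of $G_k$-modules $\mathcal T\cong\mu_3$. For $t\in k^*\setminus k^{*3}$ choose $\epsilon\in k_s$ with $\epsilon^3=t$; $\gamma_t:G_k\to\mathcal T$ is the 1-cocycle with $\gamma_t(\rho)=\mathcal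 O,\ P,\ -P$ according as $\rho(\epsilon)=\epsilon,\ \omega\epsilon,\ \omega^2\epsilon$, and $[\gamma_t]\in H^1(k,\mathcal T)$ is its class. *)

(* Defs.v *)
From HB Require Import structures.
From mathcomp Require Import all_boot all_order all_algebra.
From mathcomp Require Import separable.
From mathcomp Require Import boolp.
From mathcomp Require Import mpoly.
From mathcomp Require Import ring.
Set Implicit Arguments. Unset Strict Implicit. Unset Printing Implicit Defensive.
Import GRing.Theory.

Local Open Scope ring_scope.
Local Open Scope quotient_scope.

(* The elliptic curve y^2 = x^3 + c over K; its rational points are below
   [None], the point at infinity, and [Some (x, y)], the affine points. *)
Record mordell (K : fieldType) := Mordell {
  mcoef : K;
  mcoef_neq0 : mcoef != 0;
  mordell_pchar2 : (2 \notin [pchar K])%N;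
  mordell_pchar3 : (3 \notin [pchar K])%N }.

Section GroupLaw.
Variables (K : fieldType) (E : mordell K).
Implicit Types (x y l : K) (P Q R : option (K * K)).

Definition on_mordell P : bool :=
  if P is Some (x, y) then y ^+ 2 == x ^+ 3 + mcoef E else true.

Definition ec_opp P : option (K * K) :=
  if P is Some (x, y) then Some (x, - y) else None.

(* minus the third intersection point with the line of slope l through
   (x1, y1), when the two other ones have abscissas x1 and x2 *)
Definition third_point l x1 y1 x2 : option (K * K) :=
  let x3 := l ^+ 2 - x1 - x2 in Some (x3, l * (x1 - x3) - y1).

Definition ec_add P Q : option (K * K) :=
  match P, Q with
  | None, _ => Q
  | _, None => P
  | Some (x1, y1), Some (x2, y2) =>
    if x1 != x2 then third_point ((y2 - y1) / (x2 - x1)) x1 y1 x2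
    else if y1 == - y2 then None
    else third_point (3 * x1 ^+ 2 / (2 * y1)) x1 y1 x2
  end.

Local Notation "P ⊕ Q" := (ec_add P Q) (at level 50, left associativity).
Local Notation "⊖ P" := (ec_opp P) (at level 35, right associativity).
Local Notation on := on_mordell.

Let n2 : (2 : K) != 0.
Proof. by have := mordell_pchar2 E; rewrite inE. Qed.
Let n3 : (3 : K) != 0.
Proof. by have := mordell_pchar3 E; rewrite inE. Qed.

Let eq_oppr0 y : (y == - y) = (y == 0).
Proof.
rewrite -subr_eq0 opprK; have -> : y + y = 2 * y by ring.
by rewrite mulf_eq0 (negPf n2).
Qed.

Lemma ec_addC P Q : on P -> on Q -> P ⊕ Q = Q ⊕ P.
Proof.
case: P Q => [[x1 y1]|] [[x2 y2]|] //= /eqP e1 /eqP e2.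
rewrite [x2 == x1]eq_sym; case: eqVneq e1 => [->|nx] e1 /=.
  rewrite -[in RHS](inj_eq oppr_inj) opprK [- y2 == _]eq_sym.
  case: eqVneq => // ny.
  suff -> : y2 = y1 by [].
  apply/eqP; rewrite -subr_eq0.
  have: (y2 - y1) * (y2 + y1) == 0 by rewrite -subr_sqr e1 e2 subrr.
  by rewrite mulf_eq0 [y2 + y1]addrC [y1 + y2 == 0]addr_eq0 (negPf ny) orbF.
rewrite /third_point; congr (Some (_, _)); field;
  by rewrite ?subr_eq0 ?nx // eq_sym nx.
Qed.

Lemma ec_addN P : ⊖ P ⊕ P = None.
Proof. by case: P => [[x y]|] //=; rewrite eqxx /= eqxx. Qed.

Lemma ec_oppK P : ⊖ ⊖ P = P.
Proof. by case: P => [[x y]|] //=; rewrite opprK. Qed.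

Lemma on_opp P : on (⊖ P) = on P.
Proof. by case: P => [[x y]|] //=; rewrite sqrrN. Qed.

Lemma ec_addr0 P : P ⊕ None = P. Proof. by case: P => [[]|]. Qed.

Lemma ec_chord x1 y1 x2 y2 : x2 - x1 != 0 ->
  Some (x1, y1) ⊕ Some (x2, y2) =
  third_point ((y2 - y1) / (x2 - x1)) x1 y1 x2.
Proof. by rewrite subr_eq0 /= eq_sym => ->. Qed.

Lemma ec_double x y : y != 0 ->
  Some (x, y) ⊕ Some (x, y) = third_point (3 * x ^+ 2 / (2 * y)) x y x.
Proof. by move=> ny /=; rewrite eqxx /= eq_oppr0 (negPf ny). Qed.

Lemma on_neq x1 y1 x2 y2 : on (Some (x1, y1)) -> on (Some (x2, y2)) ->
  Some (x1, y1) <> Some (x2, y2) -> Some (x1, y1) <> ⊖ Some (x2, y2) ->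
  x2 - x1 != 0.
Proof.
move=> /= /eqP e1 /eqP e2 h1 h2; rewrite subr_eq0; apply/eqP => ex.
have: y1 ^+ 2 == y2 ^+ 2 by rewrite e1 e2 ex.
by rewrite eqf_sqr => /orP[]/eqP ey; [apply: h1|apply: h2]; rewrite ex ey.
Qed.

Variant ec_add_spec P Q : option (K * K) -> Prop :=
| EcAdd0l of P = None : ec_add_spec P Q Q
| EcAdd0r of Q = None : ec_add_spec P Q P
| EcAddN of P = ⊖ Q : ec_add_spec P Q None
| EcAddD x y of P = Some (x, y) & Q = P & y != 0 :
    ec_add_spec P Q (third_point (3 * x ^+ 2 / (2 * y)) x y x)
| EcAddC x1 y1 x2 y2 of P = Some (x1, y1) & Q = Some (x2, y2) & x2 - x1 != 0 :
    ec_add_spec P Q (third_point ((y2 - y1) / (x2 - x1)) x1 y1 x2).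

Lemma ec_addP P Q : on P -> on Q -> ec_add_spec P Q (P ⊕ Q).
Proof.
case: P => [[x1 y1]|]; last by move=> _ _; apply: EcAdd0l.
case: Q => [[x2 y2]|]; last by move=> _ _; apply: EcAdd0r.
move=> o1 o2.
case: (eqVneq (Some (x1, y1)) (⊖ Some (x2, y2))) => [-> | /eqP h1].
  by rewrite ec_addN; apply: EcAddN.
case: (eqVneq (Some (x1, y1)) (Some (x2, y2))) => [h2 | /eqP h2].
  case: h2 h1 => <- <- h1.
  have ny : y1 != 0 by apply/eqP => y0; apply: h1; rewrite /= y0 oppr0.
  by rewrite ec_double //; apply: EcAddD.
have nx := on_neq o1 o2 h2 h1.
by rewrite ec_chord //; apply: EcAddC.
Qed.

Lemma on_add P Q : on P -> on Q -> on (P ⊕ Q).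
Proof.
move=> oP oQ; case: ec_addP => //.
  move=> x y eP _ ny; move: oP; rewrite eP /= => /eqP e.
  by apply/eqP; field: e; rewrite n2 ny.
move=> x1 y1 x2 y2 eP eQ nx; move: oP oQ; rewrite eP eQ /= => /eqP e1 /eqP e2.
have ec : mcoef E = y1 ^+ 2 - x1 ^+ 3 by rewrite e1; ring.
rewrite ec in e2 *.
by apply/eqP; field: e2.
Qed.

Lemma ec_oppD P Q : ⊖ (P ⊕ Q) = ⊖ P ⊕ ⊖ Q.
Proof.
case: P => [[x1 y1]|] //; case: Q => [[x2 y2]|] //=.
case: eqVneq => [<-|nx] /=.
  rewrite eqr_opp; case: eqVneq => //= ny.
  rewrite /third_point; congr (Some (_, _)); rewrite mulrN invrN; ring.
rewrite /third_point; congr (Some (_, _)); ring.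
Qed.

Lemma ec_addK P Q : on P -> on Q -> (P ⊕ Q) ⊕ ⊖ Q = P.
Proof.
move=> oP oQ; have oR := on_add oP oQ; have oNQ : on (⊖ Q) by rewrite on_opp.
have e0 := mcoef_neq0 E.
move: oR; case: ec_addP => //.
- by move=> -> _; rewrite ec_addC // ec_addN.
- by move=> -> _; rewrite ec_addr0.
- move=> x y eP ->; rewrite {}eP in oP oNQ * => ny; rewrite {}/third_point.
  set l := _ / _; set X := _ - x - x; set Y := _ - y => oR.
  have el : 2 * l * y = 3 * x ^+ 2 by rewrite /l; field; rewrite n2 ny.
  have /eqP e : y ^+ 2 == x ^+ 3 + mcoef E := oP.
  case: (eqVneq X x) => [eX|nX].
    have eY : Y = - y by rewrite /Y eX subrr mulr0 add0r.
    rewrite eX eY ec_double ?oppr_eq0 // /third_point.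
    have -> : 3 * x ^+ 2 / (2 * - y) = - l by rewrite /l; field; rewrite ?oppr_eq0 n2 ny.
    have -> : (- l) ^+ 2 - x - x = x by rewrite -[RHS]eX /X; ring.
    by congr (Some (_, _)); ring.
  rewrite ec_chord ?subr_eq0 1?eq_sym // /third_point.
  have -> : (- y - Y) / (x - X) = - l.
    by rewrite /Y; field; rewrite subr_eq0 eq_sym.
  by congr (Some (_, _)); rewrite /Y /X; ring.
- move=> x1 y1 x2 y2 eP eQ; rewrite {}eP {}eQ in oP oQ oNQ * => nx.
  rewrite {}/third_point.
  set l := _ / _; set X := _ - x1 - x2; set Y := _ - y1 => oR.
  have el : y2 = l * (x2 - x1) + y1 by rewrite /l; field.
  have /eqP e1 : y1 ^+ 2 == x1 ^+ 3 + mcoef E := oP.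
  have /eqP e2 : y2 ^+ 2 == x2 ^+ 3 + mcoef E := oQ.
  have ec : mcoef E = y1 ^+ 2 - x1 ^+ 3 by rewrite e1; ring.
  have el2 : l * (y1 + y2) = x1 ^+ 2 + x1 * x2 + x2 ^+ 2.
    apply: (mulfI nx); rewrite /l; rewrite ec in e2; field: e2; exact: nx.
  case: (eqVneq X x2) => [eX|nX].
    have eY : Y = - y2 by rewrite /Y eX el; ring.
    have eX1 : l ^+ 2 = x1 + 2 * x2.
      have -> : l ^+ 2 = X + x1 + x2 by rewrite /X; ring.
      by rewrite eX; ring.
    have el3 : 2 * l * y2 = 3 * x2 ^+ 2.
      have -> : 2 * l * y2 = l * (y1 + y2) + l ^+ 2 * (x2 - x1).
        by rewrite el; ring.
      by rewrite el2 eX1; ring.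
    have ny2 : y2 != 0.
      apply: contra_neq e0 => y0; move: el3; rewrite y0 mulr0 => /esym/eqP.
      rewrite mulf_eq0 (negPf n3) expf_eq0 /= => /eqP x0.
      by move: e2; rewrite y0 x0 !expr0n /= add0r => <-.
    rewrite eX eY ec_double ?oppr_eq0 // /third_point.
    have -> : 3 * x2 ^+ 2 / (2 * - y2) = - l by rewrite -el3; field; rewrite ?oppr_eq0 n2 ny2.
    have -> : (- l) ^+ 2 - x2 - x2 = x1 by rewrite sqrrN eX1; ring.
    by congr (Some (_, _)); rewrite el; ring.
  rewrite ec_chord ?subr_eq0 1?eq_sym // /third_point.
  have -> : (- y2 - Y) / (x2 - X) = - l.
    by rewrite /Y el; field; rewrite subr_eq0 eq_sym.
  by congr (Some (_, _)); rewrite /Y /X; ring.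
Qed.

Lemma ec_subK P Q : on P -> on Q -> (P ⊕ ⊖ Q) ⊕ Q = P.
Proof. by move=> oP oQ; rewrite -{2}[Q]ec_oppK ec_addK ?on_opp. Qed.

Lemma ec_addKl P Q : on P -> on Q -> ⊖ P ⊕ (P ⊕ Q) = Q.
Proof.
move=> oP oQ; rewrite [P ⊕ Q]ec_addC // ec_addC ?on_opp ?on_add //.
exact: ec_addK.
Qed.

Lemma ec_add_neq0 P Q : on P -> on Q -> P <> ⊖ Q -> P ⊕ Q <> None.
Proof.
by move=> oP oQ h e; apply: h; rewrite -[LHS](ec_addK oP oQ) e.
Qed.

Lemma ec_addI P Q R : on P -> on Q -> on R -> P ⊕ Q = P ⊕ R -> Q = R.
Proof.
by move=> oP oQ oR e; rewrite -(ec_addKl oP oQ) e ec_addKl.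
Qed.

Lemma ec_add_id P Q : on P -> on Q -> P ⊕ Q = P -> Q = None.
Proof.
by move=> oP oQ e; apply: (@ec_addI P) => //; rewrite e ec_addr0.
Qed.

Lemma clear_den (a b d : K) : d != 0 -> b != 0 -> b * d = a -> a != 0.
Proof. by move=> d0 b0 <-; rewrite mulf_neq0. Qed.

Lemma assoc_chord P Q R : on P -> on Q -> on R ->
    P <> None -> Q <> None -> R <> None ->
    P <> Q -> P <> ⊖ Q -> Q <> R -> Q <> ⊖ R ->
    P ⊕ Q <> R -> P ⊕ Q <> ⊖ R -> P <> Q ⊕ R -> P <> ⊖ (Q ⊕ R) ->
  (P ⊕ Q) ⊕ R = P ⊕ (Q ⊕ R).
Proof.
case: P => [[x1 y1]|] //; case: Q => [[x2 y2]|] //; case: R => [[x3 y3]|] //.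
move=> oP oQ oR _ _ _ h1 h2 h3 h4.
have oPQ := on_add oP oQ; have oQR := on_add oQ oR.
have d1 := on_neq oP oQ h1 h2; have d2 := on_neq oQ oR h3 h4.
rewrite [Some (x1, y1) ⊕ _]ec_chord // [Some (x2, y2) ⊕ _]ec_chord //
  /third_point in oPQ oQR *.
move=> h5 h6 h7 h8.
have d3 := on_neq oPQ oR h5 h6; have d4 := on_neq oP oQR h7 h8.
rewrite !ec_chord // /third_point.
have /eqP e1 : y1 ^+ 2 == x1 ^+ 3 + mcoef E := oP.
have /eqP e2 : y2 ^+ 2 == x2 ^+ 3 + mcoef E := oQ.
have /eqP e3 : y3 ^+ 2 == x3 ^+ 3 + mcoef E := oR.
have ec : mcoef E = y1 ^+ 2 - x1 ^+ 3 by rewrite e1; ring.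
rewrite {}ec in e2 e3.
congr (Some (_, _)); field: e2 e3; rewrite d1 d2 /=; apply/andP; split.
all: try by apply: (clear_den (d := (x2 - x1) ^+ 2) _ d3);
   [rewrite expf_neq0 | field].
all: by apply: (clear_den (d := (x3 - x2) ^+ 2) _ d4);
   [rewrite expf_neq0 | field].
Qed.

Lemma double_neq0 x y : on (Some (x, y)) ->
  Some (x, y) <> ⊖ Some (x, y) -> y != 0.
Proof. by move=> o h; apply/eqP => y0; apply: h; rewrite /= y0 oppr0. Qed.

Lemma assoc_double P R : on P -> on R -> P <> None -> R <> None ->
    P <> ⊖ P -> P <> R -> P <> ⊖ R ->
    P ⊕ P <> R -> P ⊕ P <> ⊖ R -> P <> P ⊕ R -> P <> ⊖ (P ⊕ R) ->
  (P ⊕ P) ⊕ R = P ⊕ (P ⊕ R).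
Proof.
case: P => [[x1 y1]|] //; case: R => [[x3 y3]|] //.
move=> oP oR _ _ h0 h1 h2.
have oPP := on_add oP oP; have oPR := on_add oP oR.
have d1 := on_neq oP oR h1 h2; have d0 := double_neq0 oP h0.
rewrite ec_double // [Some (x1, y1) ⊕ Some (x3, _)]ec_chord //
  /third_point in oPP oPR *.
move=> h5 h6 h7 h8.
have d3 := on_neq oPP oR h5 h6; have d4 := on_neq oP oPR h7 h8.
rewrite !ec_chord // /third_point.
have /eqP e1 : y1 ^+ 2 == x1 ^+ 3 + mcoef E := oP.
have /eqP e3 : y3 ^+ 2 == x3 ^+ 3 + mcoef E := oR.
have ec : mcoef E = y1 ^+ 2 - x1 ^+ 3 by rewrite e1; ring.
rewrite {}ec in e3.
congr (Some (_, _)); field: e3; rewrite d1 d0 n2 /=.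
all: try (apply/andP; split).
all: try by apply: (clear_den (d := (2 * y1) ^+ 2) _ d3);
   [rewrite expf_neq0 ?mulf_neq0 | field; rewrite d0 n2].
all: by apply: (clear_den (d := (x3 - x1) ^+ 2) _ d4);
   [rewrite expf_neq0 | field].
Qed.

Lemma assoc_four P : on P -> P <> None ->
    P <> ⊖ P -> P ⊕ P <> ⊖ (P ⊕ P) -> P <> P ⊕ P -> P <> ⊖ (P ⊕ P) ->
    P <> P ⊕ (P ⊕ P) -> P <> ⊖ (P ⊕ (P ⊕ P)) ->
  (P ⊕ P) ⊕ (P ⊕ P) = P ⊕ (P ⊕ (P ⊕ P)).
Proof.
case: P => [[x y]|] // oP _ h0; have d0 := double_neq0 oP h0.
have o2 := on_add oP oP; have o3 := on_add oP o2.
rewrite !(ec_double x d0) /third_point in o2 o3 *.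
move=> h1 h2 h3; have d1 := double_neq0 o2 h1; have d2 := on_neq oP o2 h2 h3.
rewrite (ec_chord _ _ d2) /third_point in o3 * => h4 h5.
have d3 := on_neq oP o3 h4 h5.
rewrite (ec_double _ d1) (ec_chord _ _ d3) /third_point.
have /eqP e1 : y ^+ 2 == x ^+ 3 + mcoef E := oP.
have dy : 2 * y != 0 by rewrite mulf_neq0.
congr (Some (_, _)); field; rewrite d0 n2 /=.
all: apply/andP; split; [|apply/andP; split].
all: try by apply: (clear_den (d := (2 * y) ^+ 2) _ d2);
   [rewrite expf_neq0 | field; rewrite d0 n2].
all: try by apply: (clear_den (d := (2 * y) ^+ 3) _ d1);
   [rewrite expf_neq0 | field; rewrite d0 n2].
all: apply: (clear_den (d := (2 * y) ^+ 6 *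
  ((3 * x ^+ 2 / (2 * y)) ^+ 2 - x - x - x) ^+ 2) _ d3);
  first by rewrite mulf_neq0 ?expf_neq0.
all: field; rewrite d0 n2 /= ; apply: (clear_den (d := (2 * y) ^+ 2) _ d2);
   [by rewrite expf_neq0 | by field; rewrite d0 n2].
Qed.

Lemma assoc_two P Q : on P -> on Q -> P <> None -> Q <> None ->
    P <> Q -> P <> ⊖ Q -> Q = ⊖ Q -> P <> ⊖ P -> P ⊕ Q <> ⊖ (P ⊕ Q) ->
  (P ⊕ Q) ⊕ (P ⊕ Q) = P ⊕ P.
Proof.
case: P => [[x1 y1]|] //; case: Q => [[x2 y2]|] //.
move=> oP oQ _ _ h1 h2 [] /eqP.
rewrite eq_oppr0 => /eqP y0 h3; have d0 := double_neq0 oP h3.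
have oPQ := on_add oP oQ.
have d1 := on_neq oP oQ h1 h2.
rewrite !(ec_chord _ _ d1) /third_point in oPQ * => h4.
have d2 := double_neq0 oPQ h4.
rewrite !ec_double // /third_point.
have /eqP e1 : y1 ^+ 2 == x1 ^+ 3 + mcoef E := oP.
have /eqP e2 : y2 ^+ 2 == x2 ^+ 3 + mcoef E := oQ.
have ec : mcoef E = y1 ^+ 2 - x1 ^+ 3 by rewrite e1; ring.
rewrite {}ec y0 expr0n /= in e2 d2 *.
have e3 : y1 ^+ 2 = x1 ^+ 3 - x2 ^+ 3.
  apply/eqP; rewrite -subr_eq0; apply/eqP; move/esym: e2 => e2; rewrite -[RHS]e2; ring.
congr (Some (_, _)); field: e3; rewrite d0 d1 n2 /= ?andbT.
all: by apply: (clear_den (d := (x2 - x1) ^+ 3) _ d2);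
  [rewrite expf_neq0 | field].
Qed.

Lemma assoc_red P Q R : on P -> on Q -> on R ->
    (P <> None -> Q <> None -> R <> None -> P <> ⊖ Q -> Q <> ⊖ R ->
     P ⊕ Q <> ⊖ R -> P <> ⊖ (Q ⊕ R) -> P <> R ->
     (P ⊕ Q) ⊕ R = P ⊕ (Q ⊕ R)) ->
  (P ⊕ Q) ⊕ R = P ⊕ (Q ⊕ R).
Proof.
move=> oP oQ oR H.
have [->//|/eqP P0] := eqVneq P None.
have [->|/eqP Q0] := eqVneq Q None; first by rewrite ec_addr0.
have [->|/eqP R0] := eqVneq R None; first by rewrite !ec_addr0.
have [->|/eqP h1] := eqVneq P (⊖ Q); first by rewrite ec_addN ec_addKl.
have [eQ|/eqP h2] := eqVneq Q (⊖ R).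
  have -> : R = ⊖ Q by rewrite eQ ec_oppK.
  by rewrite ec_addK // [Q ⊕ _]ec_addC ?on_opp // ec_addN ec_addr0.
have [e|/eqP h3] := eqVneq (P ⊕ Q) (⊖ R).
  rewrite e ec_addN; have -> : R = ⊖ Q ⊕ ⊖ P.
    by rewrite -[LHS]ec_oppK -e ec_oppD ec_addC ?on_opp.
  rewrite -{1}[Q]ec_oppK ec_addKl ?on_opp //.
  by rewrite ec_addC ?on_opp // ec_addN.
have [e|/eqP h4] := eqVneq P (⊖ (Q ⊕ R)).
  rewrite {2}e ec_addN e [Q ⊕ R]ec_addC // ec_oppD ec_subK ?on_opp //.
  by rewrite ec_addN.
have [->|/eqP h5] := eqVneq P R; last exact: H.
by rewrite ec_addC ?on_add // [R ⊕ Q]ec_addC.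
Qed.

Lemma ec_double_addA P R : on P -> on R -> (P ⊕ P) ⊕ R = P ⊕ (P ⊕ R).
Proof.
move=> oP oR; have oPP := on_add oP oP; have oPR := on_add oP oR.
apply: assoc_red => // P0 _ R0 h1 h2 h3 h4 h5.
have hR : P <> P ⊕ R by move=> /esym/ec_add_id => /(_ oP oR).
have hP : P <> P ⊕ P by move=> /esym/ec_add_id => /(_ oP oP).
have [e|/eqP h6] := eqVneq (P ⊕ P) R; last exact: assoc_double.
rewrite -{}e in R0 h2 h3 h4 h5 hR *; apply: assoc_four => //.
Qed.

Lemma ec_sum_addA P Q : on P -> on Q ->
  (P ⊕ Q) ⊕ (P ⊕ Q) = P ⊕ (Q ⊕ (P ⊕ Q)).
Proof.
move=> oP oQ; have oPQ := on_add oP oQ.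
apply: assoc_red => // P0 Q0 R0 h1 h2 h3 h4 h5.
have [<-|/eqP h6] := eqVneq P Q; first by rewrite ec_double_addA ?on_add.
have hQ : Q <> P ⊕ Q.
  by rewrite ec_addC // => /esym/ec_add_id => /(_ oQ oP).
have hP : P <> P ⊕ Q by move=> /esym/ec_add_id => /(_ oP oQ).
have [e|/eqP h8] := eqVneq P (Q ⊕ (P ⊕ Q)).
  have eQ : Q = ⊖ Q.
    apply: (@ec_addI P); rewrite ?on_opp //.
    by rewrite {2}e [Q ⊕ _]ec_addC // ec_addK.
  rewrite -e; apply: assoc_two => // eP.
  by apply: h3; rewrite ec_oppD -eQ -eP.
rewrite [Q ⊕ (P ⊕ Q)]ec_addC // in h8 *.
have -> : (P ⊕ Q) ⊕ (P ⊕ Q) = (P ⊕ (P ⊕ Q)) ⊕ Q.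
  rewrite -[LHS](@ec_subK _ Q) ?on_add // ec_double_addA ?on_opp //.
  by rewrite ec_addK // [(P ⊕ Q) ⊕ P]ec_addC.
apply: assoc_red => // _ _ _ k1 k2 k3 k4 _.
have [e|/eqP h7] := eqVneq (P ⊕ (P ⊕ Q)) Q.
  have eP : P = ⊖ P.
    apply: (@ec_addI Q); rewrite ?on_opp //.
    by rewrite -{2}e [P ⊕ (P ⊕ Q)]ec_addC // ec_addK // ec_addC.
  have oQQ := on_add oQ oQ; have oQQP := on_add oQQ oP.
  rewrite e; have -> : (P ⊕ Q) ⊕ Q = (Q ⊕ Q) ⊕ P.
    by rewrite ec_addC // [P ⊕ Q]ec_addC // ec_double_addA.
  by rewrite [RHS]ec_addC // [X in _ = _ ⊕ X]eP ec_addK.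
by apply: assoc_chord => // /esym.
Qed.

Lemma ec_addA P Q R : on P -> on Q -> on R ->
  (P ⊕ Q) ⊕ R = P ⊕ (Q ⊕ R).
Proof.
move=> oP oQ oR; have oPQ := on_add oP oQ; have oQR := on_add oQ oR.
apply: assoc_red => // P0 Q0 R0 h1 h2 h3 h4 h5.
have [<-|/eqP h6] := eqVneq P Q; first exact: ec_double_addA.
have [<-|/eqP h7] := eqVneq Q R.
  by rewrite ec_addC // [P ⊕ Q]ec_addC // -ec_double_addA // ec_addC ?on_add.
have [<-|/eqP h8] := eqVneq (P ⊕ Q) R; first exact: ec_sum_addA.
have [->|/eqP h9] := eqVneq P (Q ⊕ R); last exact: assoc_chord.
have oRQ := on_add oR oQ.
rewrite [Q ⊕ R]ec_addC // ec_sum_addA // [LHS]ec_addC ?on_add //.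
by rewrite [(R ⊕ Q) ⊕ Q]ec_addC.
Qed.

End GroupLaw.

Section Points.
Variables (K : fieldType) (E : mordell K).

(* E(K) *)
Definition mpoint := {P : option (K * K) | on_mordell E P}.
HB.instance Definition _ := Choice.on mpoint.

Definition mpoint_zero : mpoint := Sub None isT.
Definition mpoint_opp (P : mpoint) : mpoint :=
  Sub (ec_opp (val P)) (etrans (on_opp E (val P)) (valP P)).
Definition mpoint_add (P Q : mpoint) : mpoint :=
  Sub (ec_add (val P) (val Q)) (on_add (valP P) (valP Q)).

Fact mpoint_addA : associative mpoint_add.
Proof. by move=> P Q R; apply/val_inj; rewrite /= (@ec_addA K E) ?(valP). Qed.
Fact mpoint_addC : commutative mpoint_add.
Proof. by move=> P Q; apply/val_inj; apply: (@ec_addC K E); apply: valP. Qed.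
Fact mpoint_add0 : left_id mpoint_zero mpoint_add.
Proof. by move=> P; apply/val_inj. Qed.
Fact mpoint_addN : left_inverse mpoint_zero mpoint_opp mpoint_add.
Proof. by move=> P; apply/val_inj; apply: ec_addN. Qed.

HB.instance Definition _ := GRing.isZmodule.Build mpoint
  mpoint_addA mpoint_addC mpoint_add0 mpoint_addN.

End Points.

Section BaseChange.
Variables (k K : fieldType) (iota : {rmorphism k -> K}) (E : mordell k).

Fact base_change_neq0 : iota (mcoef E) != 0.
Proof. by rewrite fmorph_eq0 mcoef_neq0. Qed.
Fact base_change_pchar2 : (2 \notin [pchar K])%N.
Proof. by rewrite (fmorph_pchar iota) mordell_pchar2. Qed.
Fact base_change_pchar3 : (3 \notin [pchar K])%N.
Proof. by rewrite (fmorph_pchar iota) mordell_pchar3. Qed.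

Definition base_change : mordell K :=
  Mordell base_change_neq0 base_change_pchar2 base_change_pchar3.

End BaseChange.

Definition is_separable_closure (k ks : fieldType)
    (iota : {rmorphism k -> ks}) : Prop :=
  (forall x : ks, exists2 p : {poly k},
     separable_poly p & root (map_poly iota p) x) /\
  (forall q : {poly ks}, separable_poly q -> (1 < size q)%N ->
     exists x, root q x).

Section Galois.
Variables (k ks : fieldType) (iota : {rmorphism k -> ks}).

Record galois := Galois {
  gal_fun :> {rmorphism ks -> ks};
  gal_bij : bijective gal_fun;
  gal_fix : forall a, gal_fun (iota a) = iota a }.

HB.instance Definition _ := gen_eqMixin galois.
HB.instance Definition _ := gen_choiceMixin galois.

Lemma galP (s1 s2 : galois) : s1 =1 s2 -> s1 = s2.
Proof.
case: s1 s2 => [f1 b1 h1] [f2 b2 h2] /= e.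
have ef : f1 = f2.
  case: f1 f2 e {b1 b2 h1 h2} => [f1 [[m1] [n1]]] [f2 [[m2] [n2]]] /= e.
  have {e} e : f1 = f2 by apply/funext.
  case: f2 / e m2 n2 => m2 n2.
  by rewrite (Prop_irrelevance m1 m2) (Prop_irrelevance n1 n2).
case: f2 / ef b2 h2 {e} => b2 h2.
by rewrite (Prop_irrelevance b1 b2) (Prop_irrelevance h1 h2).
Qed.

Definition gal_one : galois :=
  @Galois idfun (Bijective (frefl _) (frefl _)) (frefl _).

Fact gal_mul_fix (s1 s2 : galois) a : (s1 \o s2) (iota a) = iota a.
Proof. by rewrite /= !gal_fix. Qed.
Definition gal_mul (s1 s2 : galois) : galois :=
  @Galois (s1 \o s2) (bij_comp (gal_bij s1) (gal_bij s2)) (gal_mul_fix s1 s2).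

Fact gal_inv_subproof (s : galois) : exists s' : galois, cancel s s'.
Proof.
have [g gK Kg] := gal_bij s.
have gB : zmod_morphism g.
  by move=> x y; apply: (can_inj gK); rewrite rmorphB !Kg.
have gM : monoid_morphism g.
  split=> [|x y]; apply: (can_inj gK); first by rewrite Kg rmorph1.
  by rewrite rmorphM !Kg.
pose ga := GRing.isZmodMorphism.Build ks ks g gB.
pose gm := GRing.isMonoidMorphism.Build ks ks g gM.
pose gr : {rmorphism ks -> ks} := HB.pack g ga gm.
have gf a : gr (iota a) = iota a.
  by apply: (can_inj gK); rewrite /= Kg gal_fix.
by exists (@Galois gr (Bijective Kg gK) gf).
Qed.
Definition gal_inv (s : galois) : galois := sval (cid (gal_inv_subproof s)).

Lemma gal_invK (s : galois) : cancel s (gal_inv s).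
Proof. exact: svalP (cid (gal_inv_subproof s)). Qed.

Fact gal_mulA : associative gal_mul.
Proof. by move=> s1 s2 s3; apply: galP. Qed.
Fact gal_mul1g : left_id gal_one gal_mul.
Proof. by move=> s; apply: galP. Qed.
Fact gal_mulg1 : right_id gal_one gal_mul.
Proof. by move=> s; apply: galP. Qed.
Fact gal_mulVg : left_inverse gal_one gal_inv gal_mul.
Proof. by move=> s; apply: galP => x /=; rewrite gal_invK. Qed.
Fact gal_mulgV : right_inverse gal_one gal_inv gal_mul.
Proof.
move=> s; apply: galP => x /=; have [g gK Kg] := gal_bij s.
by rewrite -{1}[x]Kg gal_invK Kg.
Qed.

HB.instance Definition _ := isGroup.Build galois
  gal_mulA gal_mul1g gal_mulg1 gal_mulVg gal_mulgV.

(* continuity of a map from the Galois group, with its Krull topology, to a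
   discrete space *)
Definition krull_continuous (T : Type) (f : galois -> T) : Prop :=
  forall s : galois, exists A : seq ks,
    forall s' : galois, {in A, s' =1 s} -> f s' = f s.

Record galModule := GalModule {
  gm_sort :> zmodType;
  gm_act : galois -> gm_sort -> gm_sort;
  gm_actD : forall s m n, gm_act s (m + n) = gm_act s m + gm_act s n;
  gm_act1 : forall m, gm_act 1%g m = m;
  gm_actM : forall s s' m, gm_act (s * s')%g m = gm_act s (gm_act s' m);
  gm_discrete : forall m, krull_continuous (gm_act^~ m) }.

Local Notation "s • m" := (gm_act s m) (at level 40, left associativity).

Record cocycle (M : galModule) := Cocycle {
  cocycle_fun :> galois -> M;
  cocycleM : forall s s',
    cocycle_fun (s * s')%g = cocycle_fun s + s • cocycle_fun s';
  cocycle_cont : krull_continuous cocycle_fun }.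

HB.instance Definition _ M := gen_eqMixin (cocycle M).
HB.instance Definition _ M := gen_choiceMixin (cocycle M).

Section H1.
Variable M : galModule.

Lemma gm_act0 s : s • (0 : M) = 0.
Proof. by apply: (addIr (s • 0)); rewrite -gm_actD !add0r. Qed.

Lemma gm_actN s (m : M) : s • (- m) = - (s • m).
Proof. by apply: (addIr (s • m)); rewrite -gm_actD !addNr gm_act0. Qed.

Definition cohomologous (xi eta : cocycle M) : bool :=
  `[< exists m : M, forall s, eta s = xi s + (s • m - m) >].

Fact cohomologous_equiv : equiv_class_of cohomologous.
Proof.
have sym xi eta : cohomologous xi eta -> cohomologous eta xi.
  move=> /asboolP[m h]; apply/asboolP; exists (- m) => s.
  by rewrite h gm_actN -opprD addrK.
split=> [xi|xi eta|eta xi zeta].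
- by apply/asboolP; exists 0 => s; rewrite gm_act0 subr0 addr0.
- by apply/idP/idP; apply: sym.
- move=> /asboolP[m h] /asboolP[n h']; apply/asboolP; exists (m + n) => s.
  by rewrite h' h gm_actD opprD -addrA; congr (_ + _); rewrite addrACA.
Qed.
Canonical cohomologous_equiv_rel := EquivRelPack cohomologous_equiv.

Definition H1 := {eq_quot cohomologous}.
HB.instance Definition _ := Choice.on H1.
HB.instance Definition _ := EqQuotient.on H1.

Definition H1_class (xi : cocycle M) : H1 := \pi_H1 xi.

End H1.

Record galMorphism (M N : galModule) := GalMorphism {
  gmm_fun :> M -> N;
  gmmD : forall m n, gmm_fun (m + n) = gmm_fun m + gmm_fun n;
  gmm_act : forall s m, gmm_fun (s • m) = s • gmm_fun m }.

Section H1map.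
Variables (M N : galModule) (f : galMorphism M N).

Fact cocycle_mapM (xi : cocycle M) s s' :
  f (xi (s * s')%g) = f (xi s) + s • f (xi s').
Proof. by rewrite cocycleM gmmD gmm_act. Qed.
Fact cocycle_map_cont (xi : cocycle M) : krull_continuous (f \o xi).
Proof.
by move=> s; have [A hA] := cocycle_cont xi s; exists A => s' /hA /= ->.
Qed.
Definition cocycle_map (xi : cocycle M) : cocycle N :=
  Cocycle (cocycle_mapM xi) (cocycle_map_cont xi).

(* induced by f on classes, see H1_mapE *)
Definition H1_map (x : H1 M) : H1 N := H1_class (cocycle_map (repr x)).

Lemma H1_mapE xi : H1_map (H1_class xi) = H1_class (cocycle_map xi).
Proof.
apply/eqmodP; rewrite /H1_class; case: piP => eta /eqmodP /asboolP[m h].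
have f0 : f 0 = 0 by apply: (addIr (f 0)); rewrite -gmmD !add0r.
have fN n : f (- n) = - f n.
  by apply: (addIr (f n)); rewrite -gmmD !addNr f0.
apply/asboolP; exists (- f m) => s /=.
rewrite h !gmmD fN gmm_act gm_actN -opprD addrK; done.
Qed.

End H1map.

End Galois.

Section EllipticModule.
Variables (k ks : fieldType) (iota : {rmorphism k -> ks}) (E : mordell k).
Local Notation G := (galois iota).
Local Notation Es := (base_change iota E).
Local Notation Eks := (mpoint Es).

Definition gal_pair (s : G) (P : option (ks * ks)) : option (ks * ks) :=
  if P is Some (x, y) then Some (s x, s y) else None.

Fact gal_pair_on s (P : Eks) : on_mordell Es (gal_pair s (val P)).
Proof.
case: P => [[[x y]|] //= /eqP e].
by rewrite -!rmorphXn e rmorphD /= gal_fix.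
Qed.
Definition gal_mpoint s (P : Eks) : Eks := Sub _ (gal_pair_on s P).

Fact gal_mpointD s P Q :
  gal_mpoint s (P + Q) = gal_mpoint s P + gal_mpoint s Q.
Proof.
apply/val_inj; case: P Q => [[[x1 y1]|] oP] [[[x2 y2]|] oQ] //=.
rewrite -[- s y2]rmorphN !(inj_eq (fmorph_inj _)).
case: ifP => _; last case: ifP => _ //=.
  by rewrite /third_point /= !(rmorphB, rmorphXn, rmorphM, fmorphV).
by rewrite /third_point /= !(rmorphB, rmorphXn, rmorphM, fmorphV, rmorph_nat).
Qed.

Fact gal_mpoint1 P : gal_mpoint 1%g P = P.
Proof. by apply/val_inj; case: P => [[[]|]]. Qed.

Fact gal_mpointM s s' P : gal_mpoint (s * s')%g P = gal_mpoint s (gal_mpoint s' P).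
Proof. by apply/val_inj; case: P => [[[]|]]. Qed.

Fact gal_mpoint_discrete P : krull_continuous (gal_mpoint^~ P).
Proof.
move=> s; case: P => [[[x y]|] oP]; last by exists [::] => s' _; apply/val_inj.
exists [:: x; y] => s' h; apply/val_inj; rewrite /= !h //.
  by rewrite !inE eqxx orbT.
by rewrite !inE eqxx.
Qed.

(* E(ks) *)
Definition ell_module : galModule iota :=
  GalModule gal_mpointD gal_mpoint1 gal_mpointM gal_mpoint_discrete.

Section Torsion.
Variables (r : ks) (hr : r ^+ 2 = iota (mcoef E)).

Fact tpoint_on : on_mordell Es (Some (0, r)).
Proof. by rewrite /= hr expr0n add0r. Qed.
Definition tpoint : Eks := Sub _ tpoint_on.

Lemma tpointDD : tpoint + tpoint = - tpoint.
Proof.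
apply/val_inj.
have r0 : r != 0.
  apply/eqP => r0; move: hr; rewrite r0 expr0n /= => /esym/eqP.
  by rewrite fmorph_eq0 (negPf (mcoef_neq0 E)).
have -> : val (tpoint + tpoint) = ec_add (Some (0, r)) (Some (0, r)) by [].
rewrite (@ec_double ks Es) // /third_point expr0n mulr0 mul0r.
by rewrite expr0n /= !subr0 mul0r add0r.
Qed.

Definition torsion : {pred Eks} :=
  [pred P | P \in [:: 0; tpoint; - tpoint]].

Fact torsion_zmod_closed : zmod_closed torsion.
Proof.
have h := tpointDD; have h' : - tpoint - tpoint = tpoint.
  by rewrite -opprD h opprK.
split=> [|P Q]; first by rewrite !inE eqxx.
rewrite !inE => /or3P[]/eqP-> /or3P[]/eqP->;
  by rewrite ?subr0 ?sub0r ?subrr ?opprK ?h ?h' ?addNr ?eqxx ?orbT.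
Qed.
HB.instance Definition _ :=
  GRing.isZmodClosed.Build Eks torsion torsion_zmod_closed.

(* the subgroup {O, (0, r), (0, - r)} of E(ks) *)
Definition tgroup := {P : Eks | torsion P}.
HB.instance Definition _ := SubType.on tgroup.
HB.instance Definition _ := Choice.on tgroup.
HB.instance Definition _ := [SubChoice_isSubZmodule of tgroup by <:].

Fact gal_torsion s (P : tgroup) : torsion (gal_mpoint s (val P)).
Proof.
have s0 : gal_mpoint s 0 = 0 by apply/val_inj.
have sN Q : gal_mpoint s (- Q) = - gal_mpoint s Q.
  by apply/val_inj; case: Q => [[[]|]] //= *; rewrite rmorphN.
have : gal_mpoint s tpoint \in [:: tpoint; - tpoint].
  have: (s r) ^+ 2 == r ^+ 2 by rewrite -rmorphXn hr /= gal_fix.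
  rewrite eqf_sqr !inE => /orP[]/eqP e; apply/orP; [left|right];
  by apply/eqP/val_inj; rewrite /= rmorph0 e.
rewrite /torsion !inE => h; case: P => P /=.
rewrite /torsion !inE => /or3P[]/eqP->; rewrite ?s0 ?sN ?eqxx //.
by move: h => /orP[]/eqP->; rewrite ?opprK eqxx ?orbT.
Qed.
Definition gal_tgroup s (P : tgroup) : tgroup := Sub _ (gal_torsion s P).

Fact gal_tgroupD s P Q : gal_tgroup s (P + Q) = gal_tgroup s P + gal_tgroup s Q.
Proof. by apply/val_inj; apply: gal_mpointD. Qed.
Fact gal_tgroup1 P : gal_tgroup 1%g P = P.
Proof. by apply/val_inj; apply: gal_mpoint1. Qed.
Fact gal_tgroupM s s' P :
  gal_tgroup (s * s')%g P = gal_tgroup s (gal_tgroup s' P).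
Proof. by apply/val_inj; apply: gal_mpointM. Qed.
Fact gal_tgroup_discrete P : krull_continuous (gal_tgroup^~ P).
Proof.
move=> s; have [A h] := gal_mpoint_discrete (val P) s.
by exists A => s' /h e; apply/val_inj.
Qed.

Definition torsion_module : galModule iota :=
  GalModule gal_tgroupD gal_tgroup1 gal_tgroupM gal_tgroup_discrete.

Fact torsion_inclD (P Q : torsion_module) : val (P + Q) = val P + val Q.
Proof. by []. Qed.
Fact torsion_incl_act s (P : torsion_module) :
  val (gm_act s P) = gm_act (g := ell_module) s (val P).
Proof. by []. Qed.
Definition torsion_incl : galMorphism torsion_module ell_module :=
  @GalMorphism _ _ _ torsion_module ell_module _ torsion_inclD torsion_incl_act.

Fact tpoint_torsion : torsion tpoint.
Proof. by rewrite /torsion !inE eqxx orbT. Qed.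
Definition tgen : torsion_module := Sub _ tpoint_torsion.

Section Kummer.
Variables (w e : ks) (d t : k).

(* As e ^+ 3 = t, the last case is that of s e = w ^+ 2 * e. *)
Definition kummer_fun (s : G) : torsion_module :=
  if s e == e then 0 else if s e == w * e then tgen else - tgen.

Hypotheses (hw : 3.-primitive_root w) (hd : r = 3 * (2 * w + 1) * iota d).
Hypotheses (t0 : t != 0) (he : e ^+ 3 = iota t).

Let e0 : e != 0.
Proof.
apply/eqP => e0; move/eqP: he.
by rewrite e0 expr0n eq_sym fmorph_eq0 (negPf t0).
Qed.

Let T2 : tgen *+ 2 = - tgen.
Proof. by apply/val_inj; apply: tpointDD. Qed.

Let w_eq1 j : (j < 3)%N -> (w ^+ j == 1) = (j == 0)%N.
Proof. by move=> j3; rewrite -(prim_order_dvd hw) /dvdn modn_small. Qed.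

Fact kummer_funE (s : G) i : s e = w ^+ i * e -> kummer_fun s = tgen *+ i.
Proof.
have w3 : w ^+ 3 = 1 := prim_expr_order hw.
have T3 : tgen *+ 3 = 0 by rewrite mulrSr T2 addNr.
rewrite (divn_eq i 3) mulrnDr mulnC mulrnA T3 mul0rn add0r.
rewrite exprD exprM w3 expr1n mul1r => se.
have w0 : w != 0 by apply: contra_eq_neq w3 => ->; rewrite expr0n eq_sym oner_neq0.
have wne : (w == 1) = false by rewrite -[w]expr1 w_eq1.
rewrite /kummer_fun {}se -[X in _ == X]mul1r.
rewrite !(inj_eq (mulIf e0)) w_eq1 ?ltn_mod //.
have : (i %% 3 < 3)%N by rewrite ltn_mod.
case: (i %% 3)%N => [|[|[|]]] //= _; first by rewrite expr1 eqxx.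
rewrite T2 expr2; case: eqP => // /eqP.
by rewrite -{3}[w]mulr1 (inj_eq (mulfI w0)) wne.
Qed.

Fact gal_tgen (s : G) :
  exists2 m, s w = w ^+ m & gm_act s tgen = tgen *+ m.
Proof.
have sw3 : (s w) ^+ 3 = 1 by rewrite -rmorphXn (prim_expr_order hw) rmorph1.
have [[m m3] /= sw] := prim_rootP hw sw3; exists m => //.
have sr : s r = 3 * (2 * w ^+ m + 1) * iota d.
  by rewrite hd !(rmorphM, rmorphD, rmorph1, rmorph_nat, gal_fix) sw.
case: m m3 sw sr => [|[|[|]]] //= _ sw sr.
- have /eqP : s w = 1 by rewrite sw.
  by rewrite fmorph_eq1 -[w]expr1 w_eq1.
- by do 2!apply/val_inj; rewrite /= rmorph0 sr expr1 hd.
rewrite T2; do 2!apply/val_inj; rewrite /= rmorph0 sr.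
have w1 : w - 1 != 0 by rewrite subr_eq0 -[w]expr1 w_eq1.
have w2 : w ^+ 2 = - w - 1.
  apply/(mulfI w1)/eqP; rewrite -subr_eq0; apply/eqP.
  transitivity (w ^+ 3 - 1); first by ring.
  by rewrite (prim_expr_order hw) subrr.
by rewrite hd w2; congr (Some (_, _)); ring.
Qed.

Fact kummer_cocycleM s s' :
  kummer_fun (s * s')%g = kummer_fun s + gm_act s (kummer_fun s').
Proof.
have root (x : G) : exists i, x e = w ^+ i * e.
  have xe3 : (x e / e) ^+ 3 = 1.
    by rewrite expr_div_n -rmorphXn he /= gal_fix divff // fmorph_eq0.
  have [i xe] := prim_rootP hw xe3; exists i.
  by rewrite -xe divfK.
have [i si] := root s; have [j s'j] := root s'.
have [m sw sT] := gal_tgen s.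
have actn n : gm_act s (tgen *+ n) = (gm_act s tgen) *+ n.
  by elim: n => [|n IH]; rewrite ?gm_act0 // !mulrS gm_actD IH.
rewrite (kummer_funE si) (kummer_funE s'j) actn sT -mulrnA -mulrnDr.
apply: kummer_funE.
by rewrite /= s'j rmorphM rmorphXn /= sw si mulrA -exprM -exprD addnC.
Qed.
Fact kummer_cocycle_cont : krull_continuous kummer_fun.
Proof.
move=> s; exists [:: e] => s' h; rewrite /kummer_fun h //; exact: mem_head.
Qed.
Definition kummer_cocycle : cocycle torsion_module :=
  Cocycle kummer_cocycleM kummer_cocycle_cont.
End Kummer.
End Torsion.
End EllipticModule.

Section ProjectiveSpace.
Variables (K : fieldType) (n : nat).

Definition nzvec := {v : 'rV[K]_n.+1 | v != 0}.
Definition proportional (u v : nzvec) : bool := (val u <= val v)%MS.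

Fact proportional_equiv : equiv_class_of proportional.
Proof.
split=> [u|u v|v u w]; rewrite /proportional ?submx_refl //.
  suff sym (x y : nzvec) : (val x <= val y)%MS -> (val y <= val x)%MS.
    by apply/idP/idP; apply: sym.
  move=> /sub_rVP[a e]; have a0 : a != 0.
    by apply: contraNneq (valP x) => a0; rewrite e a0 scale0r.
  by apply/sub_rVP; exists a^-1; rewrite e scalerA mulVf ?scale1r.
exact: submx_trans.
Qed.
Canonical proportional_equiv_rel := EquivRelPack proportional_equiv.

Definition proj := {eq_quot proportional}.
HB.instance Definition _ := Choice.on proj.
HB.instance Definition _ := EqQuotient.on proj.

(* homogeneous coordinates *)
Definition coords (P : proj) : 'rV[K]_n.+1 := val (repr P).
Definition to_proj (v : 'rV[K]_n.+1) (v0 : v != 0) : proj :=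
  \pi_proj (exist _ v v0 : nzvec).

End ProjectiveSpace.

Section GaloisProjective.
Variables (k ks : fieldType) (iota : {rmorphism k -> ks}) (n : nat).

Fact gal_nzvec (s : galois iota) (v : nzvec ks n) : map_mx s (val v) != 0.
Proof. by rewrite map_mx_eq0 (valP v). Qed.
Definition gal_proj (s : galois iota) (P : proj ks n) : proj ks n :=
  to_proj (gal_nzvec s (repr P)).

End GaloisProjective.

Section PlaneCurves.
Variable k : fieldType.
Implicit Types (F G : {mpoly k[3]}).

Definition mpoly_eval (L : fieldType) (j : {rmorphism k -> L}) n
    (p : {mpoly k[n]}) (v : 'rV[L]_n) : L :=
  (map_mpoly j p).@[v 0].

(* Testing points over all extensions makes the condition geometric. *)
Definition smooth_plane_curve F : Prop :=
  (exists2 d, (0 < d)%N & F \is d.-homog) /\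
  forall (L : fieldType) (j : {rmorphism k -> L}) (v : 'rV[L]_3),
    v != 0 -> mpoly_eval j F v = 0 ->
    exists i, mpoly_eval j (F^`M(i)) v != 0.

Definition bihomogeneous (a b : nat) (p : {mpoly k[3 + 3]}) : Prop :=
  forall m, m \in msupp p ->
    (\sum_(i < 3) m (lshift 3 i) = a)%N /\ (\sum_(i < 3) m (rshift 3 i) = b)%N.

Definition eval_forms (L : fieldType) (j : {rmorphism k -> L})
    (f : 'I_3 -> {mpoly k[3 + 3]}) (u v : 'rV[L]_3) : 'rV[L]_3 :=
  \row_i mpoly_eval j (f i) (row_mx u v).

Section Regular.
Variables (ks : fieldType) (iota : {rmorphism k -> ks}).

(* Let X, Y be the sets of ks-points of the plane curves F = 0 and G = 0,
   and Z that of a third one.  The map phi : X * Y -> Z is induced by a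
   morphism over k: around any point (over any extension of k) it is given
   by a triple of bihomogeneous forms over k of equal bidegrees.  Note that
   the last condition holds trivially where the forms all vanish. *)
Definition regular_over F G (X Y Z : Type) (iX : X -> proj ks 2)
    (iY : Y -> proj ks 2) (iZ : Z -> proj ks 2) (phi : X -> Y -> Z) : Prop :=
  forall (L : fieldType) (j : {rmorphism k -> L}) (u v : 'rV[L]_3),
    u != 0 -> v != 0 -> mpoly_eval j F u = 0 -> mpoly_eval j G v = 0 ->
  exists (a b : nat) (f : 'I_3 -> {mpoly k[3 + 3]}),
    [/\ forall i, bihomogeneous a b (f i),
        eval_forms j f u v != 0 &
        forall x y, (eval_forms iota f (coords (iX x)) (coords (iY y))
                       <= coords (iZ (phi x y)))%MS].

Definition curve_points F :=
  {P : proj ks 2 | mpoly_eval iota F (coords P) == 0}.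

Variable E : mordell k.
Local Notation Eks := (ell_module iota E).

Definition weierstrass_form : {mpoly k[3]} :=
  let X := 'X_(inord 0) in let Y := 'X_(inord 1) in let Z := 'X_(inord 2) in
  Y ^+ 2 * Z - X ^+ 3 - mcoef E *: Z ^+ 3.

Definition mpoint_coords (P : Eks) : 'rV[ks]_3 :=
  if val P is Some (x, y) then \row_i [:: x; y; 1]`_i
  else \row_i [:: 0; 1; 0]`_i.

Fact mpoint_coords_neq0 P : mpoint_coords P != 0.
Proof.
apply/eqP => /rowP h; move: h; rewrite /mpoint_coords.
case: (val P) => [[x y]|] h.
  by have := h (inord 2); rewrite !mxE inordK //= => /eqP; rewrite oner_eq0.
by have := h (inord 1); rewrite !mxE inordK //= => /eqP; rewrite oner_eq0.
Qed.
Definition mpoint_proj (P : Eks) : proj ks 2 :=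
  to_proj (mpoint_coords_neq0 P).

Variable F : {mpoly k[3]}.
Local Notation C := (curve_points F).

(* Principal homogeneous spaces of E over k with underlying curve F = 0: C is a
   simply transitive E-set, both p + P and q - p being morphisms over k. *)
Record phs := PHS {
  phs_act : C -> Eks -> C;
  phs_sub : C -> C -> Eks;
  phs_act0 : forall p, phs_act p 0 = p;
  phs_actD : forall p P Q, phs_act (phs_act p P) Q = phs_act p (P + Q);
  phs_subK : forall p q, phs_act p (phs_sub q p) = q;
  phs_actK : forall p P, phs_sub (phs_act p P) p = P;
  phs_act_regular :
    regular_over F weierstrass_form sval mpoint_proj sval phs_act;
  phs_sub_regular :
    regular_over F F sval sval mpoint_proj phs_sub }.

(* The class of a principal homogeneous space is that of the cocycle
   s |-> s p - p, for any of its ks-points p. *)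
Definition curve_of_class (x : H1 Eks) : Prop :=
  smooth_plane_curve F /\
  exists (S : phs) (p : C) (xi : cocycle Eks),
    (forall s, gal_proj s (sval p) = sval (phs_act S p (xi s))) /\
    H1_class xi = x.

End Regular.
End PlaneCurves.

(* d is the chosen square root of Delta = - c / 27. *)
Definition C_t (k : fieldType) (d t : k) : {mpoly k[3]} :=
  let X := 'X_(inord 0) in let Y := 'X_(inord 1) in let Z := 'X_(inord 2) in
  (X ^+ 3 - t *: Y ^+ 3) - (- 54 * d * t ^+ 2) *: Z ^+ 3.

(* Main.v *)
(* Over ks, put u = 9 d z - y, v = 9 d z + y, w = x: since c = - 27 d^2, the
   curve E becomes the cubic u^3 + v^3 = 54 d w^3, with neutral element
   (-1 : 1 : 0), and the linear substitution u = X, v = - e Y, w = - e^2 Z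
   identifies it with C_t.  Transporting translations through this isomorphism
   makes C_t a principal homogeneous space whose cocycle at the image of the
   neutral element is gamma_t itself.  The action and the difference map are
   morphisms over k because the three classical addition laws of bidegree
   (2, 2) of such a cubic, namely (v1^2 u2 w2 - v2^2 u1 w1 : ...) and its two
   conjugates by pairs of opposite translations of order 3, become proportional
   to forms over k once e^3 is replaced by t; in characteristic different from
   2 and 3 they have no common zero. *)

Require Import Defs.
From mathcomp Require Import all_boot all_order all_algebra.
From mathcomp Require Import boolp mpoly ring.
Set Implicit Arguments. Unset Strict Implicit. Unset Printing Implicit Defensive.
Import GRing.Theory.
Local Open Scope ring_scope.

(** * Rows of length three *)

Section Row3.
Variable R : pzRingType.
Implicit Types (x y z : R) (v : 'rV[R]_3).

(** The body has the shape of the rows in [mpoint_coords], so that the two are convertible. *)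
Definition row3 x y z : 'rV[R]_3 := \row_i [:: x; y; z]`_i.

Lemma row3_0 x y z : row3 x y z 0 (inord 0) = x.
Proof. by rewrite mxE inordK. Qed.
Lemma row3_1 x y z : row3 x y z 0 (inord 1) = y.
Proof. by rewrite mxE inordK. Qed.
Lemma row3_2 x y z : row3 x y z 0 (inord 2) = z.
Proof. by rewrite mxE inordK. Qed.
Definition row3E := (row3_0, row3_1, row3_2).

(** Indices keep the form [inord i] that they have in the equations of the curves, so that [row3E]
    applies to them. *)
Lemma ord3P (P : 'I_3 -> Prop) :
  P (inord 0) -> P (inord 1) -> P (inord 2) -> forall i, P i.
Proof.
move=> P0 P1 P2 i; rewrite -[i]inord_val.
by case: i => [[|[|[|]]]].
Qed.

Lemma row3_eta v : v = row3 (v 0 (inord 0)) (v 0 (inord 1)) (v 0 (inord 2)).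
Proof. by apply/rowP; apply: ord3P; rewrite row3E. Qed.

Lemma scale_row3 a x y z : a *: row3 x y z = row3 (a * x) (a * y) (a * z).
Proof. by apply/rowP; apply: ord3P; rewrite [LHS]mxE !row3E. Qed.

Lemma row3_eq0 x y z : (row3 x y z == 0) = [&& x == 0, y == 0 & z == 0].
Proof.
apply/eqP/and3P => [/rowP h|[/eqP-> /eqP-> /eqP->]]; last first.
  by apply/rowP; apply: ord3P; rewrite row3E mxE.
have := h (inord 0); have := h (inord 1); have := h (inord 2).
by rewrite !row3E !mxE => -> -> ->.
Qed.

End Row3.

Lemma map_row3 (R S : pzRingType) (f : {rmorphism R -> S}) x y z :
  map_mx f (row3 x y z) = row3 (f x) (f y) (f z).
Proof. by apply/rowP; apply: ord3P; rewrite mxE !row3E. Qed.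

(** * Addition laws and linear changes of coordinates over a commutative ring *)

Section Laws.
Variable R : comNzRingType.
Implicit Types (c d t : R) (p q : 'rV[R]_3).

Definition hess_coords d p : 'rV[R]_3 :=
  let x := p 0 (inord 0) in let y := p 0 (inord 1) in let z := p 0 (inord 2) in
  row3 (9 * d * z - y) (9 * d * z + y) x.

(* Addition laws of the cubic u^3 + v^3 + c w^3 = 0 with neutral element
   (-1 : 1 : 0); each vanishes at some pairs of points, e.g. the first one on
   the diagonal.  The second and third laws are the first one computed from
   p + S and q - S, for S a point of order 3 whose translation permutes the
   coordinates up to factors. *)
Definition hess_law (l : nat) c p q : 'rV[R]_3 :=
  let u1 := p 0 (inord 0) in let v1 := p 0 (inord 1) in
  let w1 := p 0 (inord 2) in
  let u2 := q 0 (inord 0) in let v2 := q 0 (inord 1) in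
  let w2 := q 0 (inord 2) in
  match l with
  | 0%N => row3 (v1 ^+ 2 * u2 * w2 - v2 ^+ 2 * u1 * w1)
                (u1 ^+ 2 * v2 * w2 - u2 ^+ 2 * v1 * w1)
                (w1 ^+ 2 * u2 * v2 - w2 ^+ 2 * u1 * v1)
  | 1%N => row3 (c * w1 ^+ 2 * w2 * v2 - u2 ^+ 2 * u1 * v1)
                (v1 ^+ 2 * u2 * v2 - c * w2 ^+ 2 * w1 * u1)
                (u1 ^+ 2 * w2 * u2 - v2 ^+ 2 * v1 * w1)
  | _   => row3 (u1 ^+ 2 * u2 * v2 - c * w2 ^+ 2 * w1 * v1)
                (c * w1 ^+ 2 * w2 * u2 - v2 ^+ 2 * u1 * v1)
                (v1 ^+ 2 * v2 * w2 - u2 ^+ 2 * u1 * w1)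
  end.

(* [hess_law] at [p] and [hess_coords d q], pulled back by [twist] and cleared
   of [e]; see [act_law_twist] *)
Definition act_law (l : nat) d t p q : 'rV[R]_3 :=
  let X := p 0 (inord 0) in let Y := p 0 (inord 1) in let Z := p 0 (inord 2) in
  let h := hess_coords d q in
  let U := h 0 (inord 0) in let V := h 0 (inord 1) in let W := h 0 (inord 2) in
  match l with
  | 0%N => row3 (- t * (Y ^+ 2 * U * W + V ^+ 2 * X * Z))
                (X ^+ 2 * V * W - t * U ^+ 2 * Y * Z)
                (t * Z ^+ 2 * U * V + W ^+ 2 * X * Y)
  | 1%N => row3 (t * U ^+ 2 * X * Y - 54 * d * t ^+ 2 * Z ^+ 2 * V * W)
                (54 * d * t * W ^+ 2 * Z * X - t * Y ^+ 2 * U * V)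
                (t * V ^+ 2 * Y * Z - X ^+ 2 * W * U)
  | _   => row3 (X ^+ 2 * U * V + 54 * d * t * W ^+ 2 * Y * Z)
                (54 * d * t * Z ^+ 2 * W * U - V ^+ 2 * X * Y)
                (- (Y ^+ 2 * V * W) - U ^+ 2 * X * Z)
  end.

(* [hess_law] for the sum of [p] and the opposite of [q], which are points of
   C_t, in the same way; see [sub_law_twist] *)
Definition sub_hess_law (l : nat) d t p q : 'rV[R]_3 :=
  let X1 := p 0 (inord 0) in let Y1 := p 0 (inord 1) in
  let Z1 := p 0 (inord 2) in
  let X2 := q 0 (inord 0) in let Y2 := q 0 (inord 1) in
  let Z2 := q 0 (inord 2) in
  match l with
  | 0%N => row3 (- t * Y1 ^+ 2 * Y2 * Z2 - X2 ^+ 2 * X1 * Z1)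
                (X1 ^+ 2 * X2 * Z2 + t * Y2 ^+ 2 * Y1 * Z1)
                (t * (Z1 ^+ 2 * X2 * Y2 - Z2 ^+ 2 * X1 * Y1))
  | 1%N => row3 (54 * d * t * Z1 ^+ 2 * Z2 * X2 + Y2 ^+ 2 * Y1 * X1)
                (- Y1 ^+ 2 * Y2 * X2 - 54 * d * t * Z2 ^+ 2 * Z1 * X1)
                (X1 ^+ 2 * Y2 * Z2 - X2 ^+ 2 * Y1 * Z1)
  | _   => row3 (X1 ^+ 2 * X2 * Y2 - 54 * d * t ^+ 2 * Z2 ^+ 2 * Z1 * Y1)
                (54 * d * t ^+ 2 * Z1 ^+ 2 * Z2 * Y2 - X2 ^+ 2 * X1 * Y1)
                (t * (Y1 ^+ 2 * X2 * Z2 - Y2 ^+ 2 * X1 * Z1))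
  end.

(** Inverse of [hess_coords] up to the factor 18 d, which avoids division. *)
Definition weier_coords d p : 'rV[R]_3 :=
  let u := p 0 (inord 0) in let v := p 0 (inord 1) in let w := p 0 (inord 2) in
  row3 (18 * d * w) (9 * d * (v - u)) (u + v).

Definition sub_law l d t p q := weier_coords d (sub_hess_law l d t p q).

(** This is [weier_coords] at u = X, v = - e Y, w = - e^2 Z, the linear isomorphism from C_t to
    E. *)
Definition untwist e d p : 'rV[R]_3 :=
  let X := p 0 (inord 0) in let Y := p 0 (inord 1) in let Z := p 0 (inord 2) in
  row3 (- 18 * d * e ^+ 2 * Z) (- 9 * d * (X + e * Y)) (X - e * Y).

(** The linear isomorphism from E to C_t: X = u, Y = - v / e, Z = - w / e^2, multiplied by e^2 to
    clear denominators. *)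
Definition twist e d p : 'rV[R]_3 :=
  let h := hess_coords d p in
  row3 (e ^+ 2 * h 0 (inord 0)) (- e * h 0 (inord 1)) (- h 0 (inord 2)).

Definition neg_coords p : 'rV[R]_3 :=
  row3 (p 0 (inord 0)) (- p 0 (inord 1)) (p 0 (inord 2)).

Lemma untwistK e d p : twist e d (untwist e d p) = (18 * d * e ^+ 2) *: p.
Proof.
rewrite [p in RHS]row3_eta scale_row3 /twist /hess_coords /untwist !row3E.
congr row3; ring.
Qed.

Lemma twistK e d p : untwist e d (twist e d p) = (18 * d * e ^+ 2) *: p.
Proof.
rewrite [p in RHS]row3_eta scale_row3 /untwist /twist /hess_coords !row3E.
congr row3; ring.
Qed.

Lemma weier_coordsK d p : weier_coords d (hess_coords d p) = (18 * d) *: p.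
Proof.
rewrite [p in RHS]row3_eta scale_row3 /weier_coords /hess_coords !row3E.
congr row3; ring.
Qed.

Lemma twistZ e d a p : twist e d (a *: p) = a *: twist e d p.
Proof.
by rewrite scale_row3 /twist /hess_coords !row3E !mxE; congr row3; ring.
Qed.

Lemma untwistZ e d a p : untwist e d (a *: p) = a *: untwist e d p.
Proof. by rewrite scale_row3 /untwist !mxE; congr row3; ring. Qed.

Lemma hess_coordsZ d a p : hess_coords d (a *: p) = a *: hess_coords d p.
Proof. by rewrite scale_row3 /hess_coords !mxE; congr row3; ring. Qed.

Lemma weier_coordsZ d a p : weier_coords d (a *: p) = a *: weier_coords d p.
Proof. by rewrite scale_row3 /weier_coords !mxE; congr row3; ring. Qed.

Lemma hess_lawZ l c a b p q :
  hess_law l c (a *: p) (b *: q) = (a ^+ 2 * b ^+ 2) *: hess_law l c p q.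
Proof.
case: l => [|[|l]]; rewrite /hess_law scale_row3 !mxE; congr row3; ring.
Qed.

Lemma act_lawZ l d t a b p q :
  act_law l d t (a *: p) (b *: q) = (a ^+ 2 * b ^+ 2) *: act_law l d t p q.
Proof.
case: l => [|[|l]]; rewrite /act_law /hess_coords !row3E scale_row3 !mxE;
  congr row3; ring.
Qed.

Lemma sub_lawZ l d t a b p q :
  sub_law l d t (a *: p) (b *: q) = (a ^+ 2 * b ^+ 2) *: sub_law l d t p q.
Proof.
case: l => [|[|l]];
  rewrite /sub_law /sub_hess_law /weier_coords !row3E scale_row3 !mxE;
  congr row3; ring.
Qed.

(** Written on C_t, the three coordinates of a law share one power of e up to powers of e^3.
    Dividing it out leaves forms in t = e^3; the scalar a records what was divided out. *)
Lemma act_law_twist l d e p q :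
  exists a, act_law l d (e ^+ 3) (twist e d p) q =
    a *: let h := hess_law l (- 54 * d) (hess_coords d p) (hess_coords d q) in
      row3 (e ^+ 2 * h 0 (inord 0)) (- e * h 0 (inord 1)) (- h 0 (inord 2)).
Proof.
exists (match l with 0%N => - e ^+ 3 | 1%N => e ^+ 4 | _ => e ^+ 2 end).
case: l => [|[|l]];
  rewrite /act_law /hess_law /twist /= !row3E scale_row3; congr row3; ring.
Qed.

(** Negation on E exchanges u and v. The result lies on E, so here it is the coordinates of
    [hess_law] themselves that share a power of e up to powers of e^3. *)
Lemma sub_law_twist l d e p q :
  exists a, sub_law l d (e ^+ 3) (twist e d p) (twist e d q) =
    a *: weier_coords d
      (hess_law l (- 54 * d) (hess_coords d p)
         (hess_coords d (neg_coords q))).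
Proof.
exists (match l with 0%N => - e ^+ 6 | 1%N => e ^+ 5 | _ => - e ^+ 7 end).
case: l => [|[|l]]; rewrite /sub_law /sub_hess_law /hess_law /hess_coords
  /weier_coords /twist /neg_coords /= !row3E scale_row3; congr row3; ring.
Qed.

End Laws.

(** * The three laws compute the sum on E *)

Section HessianSum.
Variables (K : fieldType) (E : mordell K) (d : K).
Hypothesis ec : mcoef E = - 27 * d ^+ 2.

(** [mpoint_coords] on bare pairs, where [ec_add] is defined. *)
Definition pcoords (P : option (K * K)) : 'rV[K]_3 :=
  if P is Some (x, y) then row3 x y 1 else row3 0 1 0.

(** Checked in each case of the chord and tangent construction. The scalar a may be 0: this happens
    at the pairs where the law degenerates, and the equality then carries no information. *)
Lemma hess_law_add l P Q : on_mordell E P -> on_mordell E Q ->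
  exists a, hess_law l (- 54 * d) (hess_coords d (pcoords P))
      (hess_coords d (pcoords Q)) = a *: hess_coords d (pcoords (ec_add P Q)).
Proof.
have n2 : (2 : K) != 0 by have := mordell_pchar2 E; rewrite inE.
have n3 : (3 : K) != 0 by have := mordell_pchar3 E; rewrite inE.
have d0 : d != 0.
  have := mcoef_neq0 E; rewrite ec.
  by apply: contraNneq => ->; rewrite expr0n mulr0.
have n18 : (18 : K) != 0.
  by rewrite (_ : 18 = 2 * 3 ^+ 2) ?mulf_neq0 ?expf_neq0 //; ring.
move=> oP oQ.
case: (@ec_addP K E _ _ oP oQ) => //.
- move=> ->; set q := hess_coords d (pcoords Q).
  (* The neutral element is (- 1 : 1 : 0). With it as one argument, each law returns the other
     argument times one of its own coordinates, up to sign. *)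
  exists (match l with 0%N => q 0 (inord 2) | 1%N => q 0 (inord 0)
          | _ => q 0 (inord 1) end).
  rewrite [q in RHS]row3_eta; rewrite scale_row3.
  by case: l => [|[|l]]; rewrite /= /hess_coords !row3E; congr row3; ring.
- move=> ->; set p := hess_coords d (pcoords P).
  exists (match l with 0%N => - p 0 (inord 2) | 1%N => - p 0 (inord 1)
          | _ => - p 0 (inord 0) end).
  rewrite [p in RHS]row3_eta; rewrite scale_row3.
  by case: l => [|[|l]]; rewrite /= /hess_coords !row3E; congr row3; ring.
- move=> eP; rewrite {}eP; set h := hess_law _ _ _ _.
  (* The sum is (- 1 : 1 : 0), so the scalar is the second coordinate. *)
  exists (h 0 (inord 1)); rewrite {}/h /hess_coords scale_row3 !row3E.
  case: Q oQ {oP} => [[x y]|] oQ; last first.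
    by case: l => [|[|l]]; rewrite /= !row3E; congr row3; ring.
  move: oQ; rewrite /= ec => /eqP e1.
  have {}e1 : y ^+ 2 = x ^+ 3 - 27 * d ^+ 2 by rewrite e1; ring.
  by case: l => [|[|l]]; rewrite /= !row3E; congr row3; ring: e1.
- move=> x y eP eQ ny; move: oP; rewrite {}eQ {}eP /= ec => /eqP e1.
  have {}e1 : y ^+ 2 = x ^+ 3 - 27 * d ^+ 2 by rewrite e1; ring.
  set h := hess_law _ _ _ _.
  (* The sum is affine with z = 1, so its coordinates satisfy u + v = 18 d; this determines the
     scalar, here and in the chord case. *)
  exists ((h 0 (inord 0) + h 0 (inord 1)) / (18 * d)).
  rewrite /h /hess_coords !row3E /third_point scale_row3.
  case: l @h => [|[|l]] h; rewrite /= !row3E; congr row3; field: e1;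
    by rewrite d0 ny n2 n18.
- move=> x1 y1 x2 y2 eP eQ nx.
  move: oP oQ; rewrite {}eQ {}eP /= ec => /eqP e1 /eqP e2.
  set h := hess_law _ _ _ _.
  exists ((h 0 (inord 0) + h 0 (inord 1)) / (18 * d)).
  have {}e1 : y1 ^+ 2 = x1 ^+ 3 - 27 * d ^+ 2 by rewrite e1; ring.
  have {}e2 : y2 ^+ 2 = x2 ^+ 3 - 27 * d ^+ 2 by rewrite e2; ring.
  rewrite /h /hess_coords !row3E /third_point scale_row3.
  case: l @h => [|[|l]] h; rewrite /= !row3E; congr row3; field: e1 e2;
    by rewrite d0 nx n18.
Qed.

End HessianSum.

(** * The three laws have no common zero *)

Section Nonvanishing.
Variables (L : fieldType) (d t : L).
Hypotheses (n2 : (2 : L) != 0) (n3 : (3 : L) != 0) (d0 : d != 0) (t0 : t != 0).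

Let n54 : (54 : L) != 0.
Proof. by rewrite (_ : 54 = 2 * 3 ^+ 3) ?mulf_neq0 ?expf_neq0 //; ring. Qed.

Let n18 : (18 : L) != 0.
Proof. by rewrite (_ : 18 = 2 * 3 ^+ 2) ?mulf_neq0 ?expf_neq0 //; ring. Qed.

Let n9 : (9 : L) != 0.
Proof. by rewrite (_ : 9 = 3 ^+ 2) ?expf_neq0 //; ring. Qed.

Lemma eq0_cubes (a b x y : L) : a != 0 -> b != 0 ->
  a * x ^+ 3 + b * y ^+ 3 = 0 -> (x == 0) = (y == 0).
Proof.
move=> a0 b0 h; apply/eqP/eqP => z0; apply/eqP; move/eqP: h;
  by rewrite z0 expr0n mulr0 ?add0r ?addr0 mulf_eq0 expf_eq0
    ?(negPf a0) ?(negPf b0).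
Qed.

Lemma hess_coords_neq0 q : q != 0 -> hess_coords d q != 0.
Proof.
apply: contra_neq => h; have := weier_coordsK d q.
rewrite h => /esym/eqP; rewrite /weier_coords !mxE !mulr0 subr0 mulr0 addr0.
rewrite (_ : row3 0 0 0 = 0); last by apply/eqP; rewrite row3_eq0 eqxx.
by rewrite scaler_eq0 !mulf_eq0 (negPf n18) (negPf d0) => /eqP.
Qed.

(** On a diagonal cubic, if one coordinate is 0 then the other two vanish together. The boolean form
    allows propositional case analysis below. *)
Lemma cubic_eq0 (a b c x y z : L) : a != 0 -> b != 0 -> c != 0 ->
    a * x ^+ 3 + b * y ^+ 3 + c * z ^+ 3 == 0 ->
  [/\ (x == 0) ==> ((y == 0) == (z == 0)),
      (y == 0) ==> ((x == 0) == (z == 0)) &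
      (z == 0) ==> ((x == 0) == (y == 0))].
Proof.
move=> a0 b0 c0 /eqP h.
split; apply/implyP => /eqP e0; apply/eqP; rewrite e0 in h.
- by apply: (eq0_cubes b0 c0); rewrite -[RHS]h; ring.
- by apply: (eq0_cubes a0 c0); rewrite -[RHS]h; ring.
- by apply: (eq0_cubes a0 b0); rewrite -[RHS]h; ring.
Qed.

Local Definition simp0 := (expr0n, mulr0, mul0r, addr0, add0r, subr0, sub0r,
  oppr0, oppr_eq0, mulf_eq0, expf_eq0, negPf n54, negPf d0, negPf t0, eqxx).

(** A common zero has no zero coordinate. Eliminating between the laws then gives U^3 = - 54 d W^3
    and U^3 = V^3, so that the equation of the second point becomes 3 U^3 = 0. *)
Lemma act_law_no_common_zero X Y Z U V W :
    [|| X != 0, Y != 0 | Z != 0] -> [|| U != 0, V != 0 | W != 0] ->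
    X ^+ 3 - t * Y ^+ 3 + 54 * d * t ^+ 2 * Z ^+ 3 == 0 ->
    U ^+ 3 + V ^+ 3 - 54 * d * W ^+ 3 == 0 ->
    - t * (Y ^+ 2 * U * W + V ^+ 2 * X * Z) == 0 ->
    X ^+ 2 * V * W - t * U ^+ 2 * Y * Z == 0 ->
    t * Z ^+ 2 * U * V + W ^+ 2 * X * Y == 0 ->
    t * U ^+ 2 * X * Y - 54 * d * t ^+ 2 * Z ^+ 2 * V * W == 0 ->
    54 * d * t * W ^+ 2 * Z * X - t * Y ^+ 2 * U * V == 0 ->
    t * V ^+ 2 * Y * Z - X ^+ 2 * W * U == 0 ->
    X ^+ 2 * U * V + 54 * d * t * W ^+ 2 * Y * Z == 0 ->
    54 * d * t * Z ^+ 2 * W * U - V ^+ 2 * X * Y == 0 ->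
    - (Y ^+ 2 * V * W) - U ^+ 2 * X * Z == 0 -> False.
Proof.
move=> p0 q0 op oq m11 m12 m13 m21 m22 m23 m31 m32 m33.
have [||||pX pY pZ] := @cubic_eq0 1 (- t) (54 * d * t ^+ 2) X Y Z;
  rewrite ?simp0 ?oner_eq0 ?mul1r ?mulNr //.
have [||||qU qV qW] := @cubic_eq0 1 1 (- (54 * d)) U V W;
  rewrite ?simp0 ?oner_eq0 ?mul1r ?mulNr //.
have [X0 Y0 Z0] : [/\ X != 0, Y != 0 & Z != 0].
  (* Each of the nine forms has two terms, and setting any one coordinate to 0 kills exactly one of
     them. The remaining monomials turn into a propositional problem on which coordinates vanish. *)
  split; apply/eqP => e0; move: p0 q0 pX pY pZ qU qV qW
    m11 m12 m13 m21 m22 m23 m31 m32 m33; rewrite e0 !simp0;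
  by case: (X == 0); case: (Y == 0); case: (Z == 0);
    case: (U == 0); case: (V == 0); case: (W == 0).
have [U0 V0 W0] : [/\ U != 0, V != 0 & W != 0].
  split; apply/eqP => e0; move: p0 q0 pX pY pZ qU qV qW
    m11 m12 m13 m21 m22 m23 m31 m32 m33; rewrite e0 !simp0;
  by case: (X == 0); case: (Y == 0); case: (Z == 0);
    case: (U == 0); case: (V == 0); case: (W == 0).
have h1 : U ^+ 3 + 54 * d * W ^+ 3 = 0.
  have n0 : t * V * X * Y != 0 by rewrite !mulf_neq0.
  apply: (mulfI n0); rewrite mulr0.
  transitivity (U * V *
      (t * U ^+ 2 * X * Y - 54 * d * t ^+ 2 * Z ^+ 2 * V * W)
    + 54 * d * t * V * W * (t * Z ^+ 2 * U * V + W ^+ 2 * X * Y)).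
    by ring.
  by rewrite (eqP m21) (eqP m13) !mulr0 addr0.
have h2 : U ^+ 3 - V ^+ 3 = 0.
  have n0 : t * X * Z * Y ^+ 2 * W != 0 by rewrite !mulf_neq0 ?expf_neq0.
  apply: (mulfI n0); rewrite mulr0.
  transitivity (t * V ^+ 2 * X * Z * (- (Y ^+ 2 * V * W) - U ^+ 2 * X * Z)
    - U ^+ 2 * X * Z * (- t * (Y ^+ 2 * U * W + V ^+ 2 * X * Z))).
    by ring.
  by rewrite (eqP m33) (eqP m11) !mulr0 subr0.
have /eqP : 3 * U ^+ 3 = 0.
  transitivity ((U ^+ 3 + 54 * d * W ^+ 3) + (U ^+ 3 - V ^+ 3)
    + (U ^+ 3 + V ^+ 3 - 54 * d * W ^+ 3)); first by ring.
  by rewrite h1 h2 (eqP oq) !addr0.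
by rewrite mulf_eq0 expf_eq0 (negPf n3) (negPf U0).
Qed.

(** The same elimination, with both points on C_t: X2^3 = - t Y2^3 and X2^3 = 54 d t^2 Z2^3 turn the
    equation of the second point into 3 X2^3 = 0. *)
Lemma sub_law_no_common_zero X1 Y1 Z1 X2 Y2 Z2 :
    [|| X1 != 0, Y1 != 0 | Z1 != 0] -> [|| X2 != 0, Y2 != 0 | Z2 != 0] ->
    X1 ^+ 3 - t * Y1 ^+ 3 + 54 * d * t ^+ 2 * Z1 ^+ 3 == 0 ->
    X2 ^+ 3 - t * Y2 ^+ 3 + 54 * d * t ^+ 2 * Z2 ^+ 3 == 0 ->
    - t * Y1 ^+ 2 * Y2 * Z2 - X2 ^+ 2 * X1 * Z1 == 0 ->
    X1 ^+ 2 * X2 * Z2 + t * Y2 ^+ 2 * Y1 * Z1 == 0 ->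
    t * (Z1 ^+ 2 * X2 * Y2 - Z2 ^+ 2 * X1 * Y1) == 0 ->
    54 * d * t * Z1 ^+ 2 * Z2 * X2 + Y2 ^+ 2 * Y1 * X1 == 0 ->
    - Y1 ^+ 2 * Y2 * X2 - 54 * d * t * Z2 ^+ 2 * Z1 * X1 == 0 ->
    X1 ^+ 2 * Y2 * Z2 - X2 ^+ 2 * Y1 * Z1 == 0 ->
    X1 ^+ 2 * X2 * Y2 - 54 * d * t ^+ 2 * Z2 ^+ 2 * Z1 * Y1 == 0 ->
    54 * d * t ^+ 2 * Z1 ^+ 2 * Z2 * Y2 - X2 ^+ 2 * X1 * Y1 == 0 ->
    t * (Y1 ^+ 2 * X2 * Z2 - Y2 ^+ 2 * X1 * Z1) == 0 -> False.
Proof.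
move=> p0 q0 op oq s1 s2 s3 s4 s5 s6 s7 s8 s9.
have [||||pX pY pZ] := @cubic_eq0 1 (- t) (54 * d * t ^+ 2) X1 Y1 Z1;
  rewrite ?simp0 ?oner_eq0 ?mul1r ?mulNr //.
have [||||qX qY qZ] := @cubic_eq0 1 (- t) (54 * d * t ^+ 2) X2 Y2 Z2;
  rewrite ?simp0 ?oner_eq0 ?mul1r ?mulNr //.
have [X10 Y10 Z10] : [/\ X1 != 0, Y1 != 0 & Z1 != 0].
  split; apply/eqP => e0; move: p0 q0 pX pY pZ qX qY qZ
    s1 s2 s3 s4 s5 s6 s7 s8 s9; rewrite e0 !simp0;
  by case: (X1 == 0); case: (Y1 == 0); case: (Z1 == 0);
    case: (X2 == 0); case: (Y2 == 0); case: (Z2 == 0).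
have [X20 Y20 Z20] : [/\ X2 != 0, Y2 != 0 & Z2 != 0].
  split; apply/eqP => e0; move: p0 q0 pX pY pZ qX qY qZ
    s1 s2 s3 s4 s5 s6 s7 s8 s9; rewrite e0 !simp0;
  by case: (X1 == 0); case: (Y1 == 0); case: (Z1 == 0);
    case: (X2 == 0); case: (Y2 == 0); case: (Z2 == 0).
have h1 : X2 ^+ 3 + t * Y2 ^+ 3 = 0.
  have n0 : t * Y1 ^+ 2 * X2 * Z2 != 0 by rewrite !mulf_neq0 ?expf_neq0.
  apply: (mulfI n0); rewrite mulr0.
  transitivity (X2 ^+ 3 * (t * (Y1 ^+ 2 * X2 * Z2 - Y2 ^+ 2 * X1 * Z1))
    - t * Y2 ^+ 2 * X2 * (- t * Y1 ^+ 2 * Y2 * Z2 - X2 ^+ 2 * X1 * Z1)).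
    by ring.
  by rewrite (eqP s9) (eqP s1) !mulr0 subr0.
have h2 : 54 * d * t ^+ 2 * Z2 ^+ 3 - X2 ^+ 3 = 0.
  have n0 : t * Z1 ^+ 2 * X2 * Y2 != 0 by rewrite !mulf_neq0 ?expf_neq0.
  apply: (mulfI n0); rewrite mulr0.
  transitivity (t * Z2 ^+ 2 * X2
      * (54 * d * t ^+ 2 * Z1 ^+ 2 * Z2 * Y2 - X2 ^+ 2 * X1 * Y1)
    - X2 ^+ 3 * (t * (Z1 ^+ 2 * X2 * Y2 - Z2 ^+ 2 * X1 * Y1))).
    by ring.
  by rewrite (eqP s8) (eqP s3) !mulr0 subr0.
have /eqP : 3 * X2 ^+ 3 = 0.
  transitivity ((X2 ^+ 3 + t * Y2 ^+ 3)
    - (54 * d * t ^+ 2 * Z2 ^+ 3 - X2 ^+ 3)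
    + (X2 ^+ 3 - t * Y2 ^+ 3 + 54 * d * t ^+ 2 * Z2 ^+ 3)); first by ring.
  by rewrite h1 h2 (eqP oq) subr0 addr0.
by rewrite mulf_eq0 expf_eq0 (negPf n3) (negPf X20).
Qed.

Definition on_Ct (p : 'rV[L]_3) : Prop :=
  p 0 (inord 0) ^+ 3 - t * p 0 (inord 1) ^+ 3
    + 54 * d * t ^+ 2 * p 0 (inord 2) ^+ 3 = 0.

Definition on_hess (h : 'rV[L]_3) : Prop :=
  h 0 (inord 0) ^+ 3 + h 0 (inord 1) ^+ 3 - 54 * d * h 0 (inord 2) ^+ 3 = 0.

Lemma row_neq0 (p : 'rV[L]_3) : p != 0 ->
  [|| p 0 (inord 0) != 0, p 0 (inord 1) != 0 | p 0 (inord 2) != 0].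
Proof. by rewrite {1}[p]row3_eta row3_eq0 !negb_and. Qed.

Lemma act_law_neq0 p q : p != 0 -> q != 0 -> on_Ct p ->
  on_hess (hess_coords d q) -> exists l, act_law l d t p q != 0.
Proof.
move=> p0 /hess_coords_neq0 q0 /eqP op /eqP oq.
have [|l0] := eqVneq (act_law 0 d t p q) 0; last by exists 0%N.
have [|l1] := eqVneq (act_law 1 d t p q) 0; last by exists 1%N.
have [|l2] := eqVneq (act_law 2 d t p q) 0; last by exists 2%N.
move=> /eqP; rewrite row3_eq0 => /and3P[m31 m32 m33].
move=> /eqP; rewrite row3_eq0 => /and3P[m21 m22 m23].
move=> /eqP; rewrite row3_eq0 => /and3P[m11 m12 m13].
by case: (act_law_no_common_zero (row_neq0 p0) (row_neq0 q0)).
Qed.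

Lemma sub_law_neq0 p q : p != 0 -> q != 0 -> on_Ct p -> on_Ct q ->
  exists l, sub_law l d t p q != 0.
Proof.
move=> p0 q0 /eqP op /eqP oq.
have weier0 u v w : weier_coords d (row3 u v w) = 0 ->
    [&& u == 0, v == 0 & w == 0].
  move=> /eqP; rewrite row3_eq0 !row3E => /and3P[w0 vu0 uv0].
  have eu : u = - v by apply/eqP; rewrite -addr_eq0.
  move: w0 vu0; rewrite eu opprK !mulf_eq0 (negPf n18) (negPf n9) (negPf d0) /=.
  by rewrite -mulr2n -mulr_natl mulf_eq0 (negPf n2) /= oppr_eq0 => -> ->.
have [/weier0|l0] := eqVneq (sub_law 0 d t p q) 0; last by exists 0%N.
have [/weier0|l1] := eqVneq (sub_law 1 d t p q) 0; last by exists 1%N.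
have [/weier0|l2] := eqVneq (sub_law 2 d t p q) 0; last by exists 2%N.
move=> /and3P[m31 m32 m33] /and3P[m21 m22 m23] /and3P[m11 m12 m13].
by case: (sub_law_no_common_zero (row_neq0 p0) (row_neq0 q0)).
Qed.

End Nonvanishing.

(** * Compatibility of the laws with ring morphisms *)

Section MapLaws.
Variables (R S : comNzRingType) (f : {rmorphism R -> S}).
Implicit Types (d t : R) (p q : 'rV[R]_3).

Lemma map_act_law l d t p q : map_mx f (act_law l d t p q) =
  act_law l (f d) (f t) (map_mx f p) (map_mx f q).
Proof.
by case: l => [|[|l]]; rewrite /act_law /hess_coords !row3E map_row3 !mxE;
  congr row3; ring.
Qed.

Lemma map_sub_law l d t p q : map_mx f (sub_law l d t p q) =
  sub_law l (f d) (f t) (map_mx f p) (map_mx f q).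
Proof.
by case: l => [|[|l]]; rewrite /sub_law /sub_hess_law /weier_coords !row3E
  map_row3 !mxE; congr row3; ring.
Qed.

End MapLaws.

(** * The laws as bihomogeneous forms *)

Section Bihomogeneous.
Variable k : fieldType.
Implicit Types (p q : {mpoly k[3 + 3]}) (a b : nat).

Lemma bihomogeneousD a b p q : bihomogeneous a b p -> bihomogeneous a b q ->
  bihomogeneous a b (p + q).
Proof.
by move=> hp hq m /msuppD_le; rewrite mem_cat => /orP[/hp|/hq].
Qed.

Lemma bihomogeneousN a b p : bihomogeneous a b p -> bihomogeneous a b (- p).
Proof. by move=> hp m; rewrite (perm_mem (msuppN _)) => /hp. Qed.

Lemma bihomogeneousM a b a' b' p q :
  bihomogeneous a b p -> bihomogeneous a' b' q ->
  bihomogeneous (a + a') (b + b') (p * q).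
Proof.
move=> hp hq m /msuppM_le /allpairsP[[m1 m2] /= [/hp[<- <-] /hq[<- <-] ->]].
by rewrite -!big_split; split; apply: eq_bigr => i _; rewrite mnmDE.
Qed.

Lemma bihomogeneousC c : bihomogeneous 0 0 (c%:MP_[3 + 3] : {mpoly k[3 + 3]}).
Proof.
move=> m; rewrite msuppC; case: eqP => // _; rewrite inE => /eqP->.
by split; apply: big1 => i _; rewrite mnm0E.
Qed.

Lemma bihomogeneous_nat n : bihomogeneous 0 0 (n%:R : {mpoly k[3 + 3]}).
Proof. by rewrite -[n%:R](rmorph_nat (@mpolyC _ k)); apply: bihomogeneousC. Qed.

Lemma bihomogeneousX a b p n : bihomogeneous a b p ->
  bihomogeneous (n * a) (n * b) (p ^+ n).
Proof.
move=> hp; elim: n => [|n IH].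
  by rewrite expr0 -mpolyC1; apply: bihomogeneousC.
by rewrite exprS !mulSn; apply: bihomogeneousM.
Qed.

Lemma bihomogeneous_lvar i :
  bihomogeneous 1 0 ('X_(lshift 3 i) : {mpoly k[3 + 3]}).
Proof.
move=> m; rewrite msuppX inE => /eqP->; split.
  rewrite (bigD1 i) //= mnm1E eqxx big1 // => j ji.
  by rewrite mnm1E (inj_eq (@lshift_inj _ _)) eq_sym (negPf ji).
by apply: big1 => j _; rewrite mnm1E eq_lrshift.
Qed.

Lemma bihomogeneous_rvar i :
  bihomogeneous 0 1 ('X_(rshift 3 i) : {mpoly k[3 + 3]}).
Proof.
move=> m; rewrite msuppX inE => /eqP->; split.
  by apply: big1 => j _; rewrite mnm1E eq_rlshift.
rewrite (bigD1 i) //= mnm1E eqxx big1 // => j ji.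
by rewrite mnm1E (inj_eq (@rshift_inj _ _)) eq_sym (negPf ji).
Qed.

(** Lets [bihom] compute a bidegree from the leaves up and compare it with the expected one
    afterwards, by conversion. *)
Lemma bihomogeneous_eq a b a' b' p :
  bihomogeneous a' b' p -> a' = a -> b' = b -> bihomogeneous a b p.
Proof. by move=> h <- <-. Qed.

Ltac bihom_monomial :=
  lazymatch goal with
  | |- bihomogeneous _ _ (_ * _) =>
      eapply bihomogeneousM; [bihom_monomial | bihom_monomial]
  | |- bihomogeneous _ _ (_ ^+ _) => eapply bihomogeneousX; bihom_monomial
  | |- bihomogeneous _ _ (- _) => eapply bihomogeneousN; bihom_monomial
  | |- bihomogeneous _ _ (_%:R) => exact: bihomogeneous_nat
  | |- _ => eassumption
  end.
Ltac bihom :=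
  lazymatch goal with
  | |- bihomogeneous _ _ (_ + _) => apply: bihomogeneousD; bihom
  | |- bihomogeneous _ _ (- _) => apply: bihomogeneousN; bihom
  | |- bihomogeneous _ _ (?c * (_ + _)) =>
      eapply bihomogeneous_eq;
      [eapply bihomogeneousM; [bihom_monomial | bihom]
      | reflexivity | reflexivity]
  | |- _ =>
      eapply bihomogeneous_eq; [bihom_monomial | reflexivity | reflexivity]
  end.

Section LawDegrees.
Variables (d t : {mpoly k[3 + 3]}) (p q : 'rV[{mpoly k[3 + 3]}]_3).
Hypotheses (hd : bihomogeneous 0 0 d) (ht : bihomogeneous 0 0 t).
Hypothesis hp : forall i, bihomogeneous 1 0 (p 0 i).

Lemma act_law_bihomogeneous l i : (forall i, bihomogeneous 0 1 (q 0 i)) ->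
  bihomogeneous 2 2 (act_law l d t p q 0 i).
Proof.
move=> hq.
have hX := @hp (inord 0); have hY := @hp (inord 1); have hZ := @hp (inord 2).
have hx := @hq (inord 0); have hy := @hq (inord 1); have hz := @hq (inord 2).
rewrite /act_law /hess_coords !row3E.
move: (p 0 (inord 0)) (p 0 (inord 1)) (p 0 (inord 2)) hX hY hZ
  => X Y Z hX hY hZ.
move: (q 0 (inord 0)) (q 0 (inord 1)) (q 0 (inord 2)) hx hy hz
  => x y z hx hy hz.
have hU : bihomogeneous 0 1 (9 * d * z - y) by bihom.
have hV : bihomogeneous 0 1 (9 * d * z + y) by bihom.
(* U and V become atoms of bidegree (0, 1), so that the coordinates are combinations of
   monomials. *)
move: (_ - y) (_ + y) hU hV => U V hU hV.
by case: l => [|[|l]]; move: i; apply: ord3P; rewrite row3E; bihom.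
Qed.

Lemma sub_law_bihomogeneous l i : (forall i, bihomogeneous 0 1 (q 0 i)) ->
  bihomogeneous 2 2 (sub_law l d t p q 0 i).
Proof.
move=> hq.
have hX := @hp (inord 0); have hY := @hp (inord 1); have hZ := @hp (inord 2).
have hx := @hq (inord 0); have hy := @hq (inord 1); have hz := @hq (inord 2).
rewrite /sub_law /sub_hess_law.
move: (p 0 (inord 0)) (p 0 (inord 1)) (p 0 (inord 2)) hX hY hZ
  => X Y Z hX hY hZ.
move: (q 0 (inord 0)) (q 0 (inord 1)) (q 0 (inord 2)) hx hy hz
  => x y z hx hy hz.
suff weier (r : 'rV_3) : (forall i, bihomogeneous 2 2 (r 0 i)) ->
    bihomogeneous 2 2 (weier_coords d r 0 i).
  by case: l => [|[|l]]; apply: weier; apply: ord3P; rewrite row3E; bihom.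
move=> hr.
have hu := @hr (inord 0); have hv := @hr (inord 1); have hw := @hr (inord 2).
rewrite /weier_coords; 
move: (r 0 (inord 0)) (r 0 (inord 1)) (r 0 (inord 2)) hu hv hw
  => u v w hu hv hw.
have hvu : bihomogeneous 2 2 (v - u) by bihom.
by move: i; apply: ord3P; rewrite row3E; bihom.
Qed.

End LawDegrees.

Definition lvars : 'rV[{mpoly k[3 + 3]}]_3 := \row_i 'X_(lshift 3 i).
Definition rvars : 'rV[{mpoly k[3 + 3]}]_3 := \row_i 'X_(rshift 3 i).

(** A law is a formula over every commutative ring; its value at the variables themselves is the
    triple of forms that [regular_over] asks for. *)
Definition law_forms
    (law : forall R : comNzRingType, R -> R -> 'rV[R]_3 -> 'rV[R]_3 -> 'rV[R]_3)
    (d t : k) (i : 'I_3) : {mpoly k[3 + 3]} :=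
  law _ d%:MP_[3 + 3] t%:MP_[3 + 3] lvars rvars 0 i.

(** Evaluation at (u, v) is a ring morphism that sends the variables to the coordinates, so the
    naturality of [law] suffices. *)
Lemma eval_law_forms
    (law : forall R : comNzRingType, R -> R -> 'rV[R]_3 -> 'rV[R]_3 -> 'rV[R]_3)
    (law_map : forall (R S : comNzRingType) (f : {rmorphism R -> S}) d t x y,
      map_mx f (law R d t x y) = law S (f d) (f t) (map_mx f x) (map_mx f y))
    (d t : k) (L : fieldType) (j : {rmorphism k -> L}) (u v : 'rV[L]_3) :
  eval_forms j (law_forms law d t) u v = law L (j d) (j t) u v.
Proof.
pose f : {rmorphism {mpoly k[3 + 3]} -> L} :=
  meval (row_mx u v 0) \o map_mpoly j.
have fE p : f p = mpoly_eval j p (row_mx u v) by [].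
have fC c : f c%:MP_[3 + 3] = j c by rewrite /f /= map_mpolyC mevalC.
have fX i : f 'X_i = row_mx u v 0 i by rewrite /f /= map_mpolyX mevalXU.
have -> : eval_forms j (law_forms law d t) u v =
    map_mx f (law _ d%:MP_[3 + 3] t%:MP_[3 + 3] lvars rvars).
  by apply/rowP => i; rewrite !mxE.
rewrite law_map !fC; congr (law _ _ _ _ _); apply/rowP => i.
  by rewrite !mxE fX row_mxEl.
by rewrite !mxE fX row_mxEr.
Qed.

End Bihomogeneous.

(** * Projective points compared by inclusion of row spaces *)

Section Rows.
Variables (K : fieldType) (n : nat).

Lemma row_sub_sym (u v : 'rV[K]_n) : u != 0 -> (u <= v)%MS -> (v <= u)%MS.
Proof.
move=> u0 /sub_rVP[a e]; have a0 : a != 0.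
  by apply: contraNneq u0 => a0; rewrite e a0 scale0r.
by apply/sub_rVP; exists a^-1; rewrite e scalerA mulVf ?scale1r.
Qed.

End Rows.

Section Proj.
Local Open Scope quotient_scope.
Variables (K : fieldType) (n : nat).
Implicit Types (P Q : proj K n) (v : 'rV[K]_n.+1).

Lemma coords_neq0 P : coords P != 0.
Proof. exact: valP (repr P). Qed.

(** [coords] takes an arbitrary representative of the class, known only up to a scalar. *)
Lemma coords_to_proj v (v0 : v != 0) : (coords (to_proj v0) <= v)%MS.
Proof.
have /eqmodP : repr (to_proj v0) = exist _ v v0 %[mod proj K n].
  by rewrite reprK.
by [].
Qed.

Lemma sub_coords_to_proj v (v0 : v != 0) : (v <= coords (to_proj v0))%MS.
Proof. by rewrite row_sub_sym ?coords_neq0 ?coords_to_proj. Qed.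

Lemma coords_inj P Q : (coords P <= coords Q)%MS -> P = Q.
Proof. by move=> h; rewrite -[P]reprK -[Q]reprK; apply/eqmodP. Qed.

End Proj.

(** * Evaluation and derivatives of polynomials *)

Section MpolyEval.
Variables (k L : fieldType) (j : {rmorphism k -> L}) (n : nat) (v : 'rV[L]_n).
Implicit Types p q : {mpoly k[n]}.

Lemma mpoly_evalX i : mpoly_eval j 'X_i v = v 0 i.
Proof. by rewrite /mpoly_eval map_mpolyX mevalXU. Qed.
Lemma mpoly_evalZ a p : mpoly_eval j (a *: p) v = j a * mpoly_eval j p v.
Proof. by rewrite /mpoly_eval map_mpolyZ mevalZ. Qed.
Lemma mpoly_evalB p q :
  mpoly_eval j (p - q) v = mpoly_eval j p v - mpoly_eval j q v.
Proof. by rewrite /mpoly_eval !rmorphB. Qed.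
Lemma mpoly_evalM p q :
  mpoly_eval j (p * q) v = mpoly_eval j p v * mpoly_eval j q v.
Proof. by rewrite /mpoly_eval !rmorphM. Qed.
Lemma mpoly_evalXn p m : mpoly_eval j (p ^+ m) v = mpoly_eval j p v ^+ m.
Proof. by rewrite /mpoly_eval !rmorphXn. Qed.
Lemma mpoly_evalMn p m : mpoly_eval j (p *+ m) v = mpoly_eval j p v *+ m.
Proof. by rewrite /mpoly_eval !raddfMn. Qed.
Definition mpoly_evalE := (mpoly_evalX, mpoly_evalZ, mpoly_evalB, mpoly_evalM,
  mpoly_evalXn, mpoly_evalMn).

End MpolyEval.

(** The Kronecker delta is kept as a multiplicity, so that one formula serves for all three partial
    derivatives. *)
Lemma mderiv_cube (k : fieldType) n (i j : 'I_n) :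
  ('X_j ^+ 3 : {mpoly k[n]})^`M(i) = 'X_j ^+ 2 *+ (3 * (j == i)).
Proof.
rewrite !mpolyXn mderivX mulmnE mnm1E; case: eqP => [->|_].
  by rewrite mulmSr addmK mul1n muln1 scaler_nat.
by rewrite mul0n muln0 scale0r mulr0n.
Qed.

(** * The equations of C_t and E, and the smoothness of C_t *)

Section Curve.
Variables (k : fieldType) (d t : k).

Lemma eval_C_t (L : fieldType) (j : {rmorphism k -> L}) (v : 'rV[L]_3) :
  mpoly_eval j (C_t d t) v = v 0 (inord 0) ^+ 3 - j t * v 0 (inord 1) ^+ 3
    + 54 * j d * j t ^+ 2 * v 0 (inord 2) ^+ 3.
Proof. by rewrite /C_t !mpoly_evalE; ring. Qed.

(** The cubic is diagonal: its partial derivatives are the squares of the coordinates times 3, - 3 t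
    and 162 d t^2, all invertible, so they vanish together only at the zero vector. *)
Lemma smooth_C_t : (3 : k) != 0 -> (2 : k) != 0 -> d != 0 -> t != 0 ->
  smooth_plane_curve (C_t d t).
Proof.
move=> n3 n2 d0 t0; split.
  exists 3%N => //.
  have cube i : ('X_i ^+ 3 : {mpoly k[3]}) \is 3.-homog.
    have Xi : ('X_i : {mpoly k[3]}) \is 1.-homog.
      by rewrite dhomogX; apply/eqP/mdeg1.
    exact: (dhomogMn 3 Xi).
  by rewrite /C_t !rpredB ?rpredZ.
move=> L j v v0 _; apply/existsP; apply: contraNT v0; rewrite negb_exists.
have n54 : (54 : L) != 0.
  rewrite -[54](rmorph_nat j) fmorph_eq0.
  by rewrite (_ : 54 = 2 * 3 ^+ 3) ?mulf_neq0 ?expf_neq0 //; ring.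
have j3 : (3 : L) != 0 by rewrite -[3](rmorph_nat j) fmorph_eq0.
have j0 a : a != 0 -> j a != 0 by rewrite fmorph_eq0.
move=> /forallP h.
have {}h (i : 'I_3) : v 0 (inord 0) ^+ 2 *+ (3 * (inord 0 == i))
    - j t * (v 0 (inord 1) ^+ 2 *+ (3 * (inord 1 == i)))
    - j (- 54 * d * t ^+ 2) * (v 0 (inord 2) ^+ 2 *+ (3 * (inord 2 == i))) = 0.
  apply/eqP; move: (h i); rewrite negbK /C_t !mderivB !mderivZ !mderiv_cube.
  by rewrite !mpoly_evalE.
have ord_eq a b : (a < 3)%N -> (b < 3)%N ->
    (inord a == inord b :> 'I_3) = (a == b).
  by move=> a3 b3; rewrite -val_eqE /= !inordK.
have j54 : j (- 54 * d * t ^+ 2) != 0.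
  rewrite j0 // !mulf_neq0 ?oppr_eq0 ?expf_neq0 //.
  by rewrite -(fmorph_eq0 j) rmorph_nat.
have vn0 a : v 0 a ^+ 2 *+ 3 = 0 -> v 0 a == 0.
  by move/eqP; rewrite -mulr_natl mulf_eq0 (negPf j3) expf_eq0.
rewrite [v]row3_eta row3_eq0; apply/and3P; split; apply: vn0.
- have := h (inord 0); rewrite eqxx ord_eq // ord_eq //.
  by rewrite !muln0 !mulr0n !mulr0 !subr0.
- have := h (inord 1); rewrite eqxx ord_eq // ord_eq //.
  rewrite !muln0 !mulr0n !mulr0 subr0 sub0r => /eqP.
  by rewrite oppr_eq0 mulf_eq0 (negPf (j0 _ t0)) => /eqP.
- have := h (inord 2); rewrite eqxx ord_eq // ord_eq //.
  rewrite !muln0 !mulr0n !mulr0 subr0 sub0r => /eqP.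
  by rewrite oppr_eq0 mulf_eq0 (negPf j54) => /eqP.
Qed.

End Curve.

Section Weierstrass.
Variables (k : fieldType) (E : mordell k).

Lemma eval_weierstrass (L : fieldType) (j : {rmorphism k -> L}) (v : 'rV[L]_3) :
  mpoly_eval j (weierstrass_form E) v =
    v 0 (inord 1) ^+ 2 * v 0 (inord 2) - v 0 (inord 0) ^+ 3
    - j (mcoef E) * v 0 (inord 2) ^+ 3.
Proof. by rewrite /weierstrass_form !mpoly_evalE. Qed.
End Weierstrass.

(** * The torsor structure on C_t *)

Section Torsor.
Variables (k ks : fieldType) (iota : {rmorphism k -> ks}) (E : mordell k).
Variables (d t : k) (e : ks).
Hypothesis ec : mcoef E = - 27 * d ^+ 2.
Hypotheses (t0 : t != 0) (he : e ^+ 3 = iota t).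

Local Notation D := (iota d).
Local Notation Es := (base_change iota E).
Local Notation Eks := (ell_module iota E).
Local Notation C := (curve_points iota (C_t d t)).
Local Notation mc := (@mpoint_coords k ks iota E).

Let n2 : (2 : k) != 0.
Proof. by have := mordell_pchar2 E; rewrite inE. Qed.
Let n3 : (3 : k) != 0.
Proof. by have := mordell_pchar3 E; rewrite inE. Qed.
Let d0 : d != 0.
Proof.
have := mcoef_neq0 E; rewrite ec.
by apply: contraNneq => ->; rewrite expr0n mulr0.
Qed.
Let D0 : D != 0. Proof. by rewrite fmorph_eq0. Qed.
Let e0 : e != 0.
Proof. by have : e ^+ 3 != 0 by [rewrite he fmorph_eq0|]; rewrite expf_eq0. Qed.
Let n18 : (18 : ks) != 0.
Proof.
rewrite -[18](rmorph_nat iota) fmorph_eq0.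
by rewrite (_ : 18 = 2 * 3 ^+ 2) ?mulf_neq0 ?expf_neq0 //; ring.
Qed.
Let n54 : (54 : ks) != 0.
Proof.
rewrite -[54](rmorph_nat iota) fmorph_eq0.
by rewrite (_ : 54 = 2 * 3 ^+ 3) ?mulf_neq0 ?expf_neq0 //; ring.
Qed.
Let scale_neq0 : 18 * D * e ^+ 2 != 0.
Proof. by rewrite !mulf_neq0 ?expf_neq0. Qed.

Let ecs : mcoef Es = - 27 * D ^+ 2.
Proof. by rewrite /= ec; ring. Qed.

Lemma mpoint_coordsE (P : Eks) : mc P = pcoords (val P).
Proof. by rewrite /mpoint_coords; case: (val P) => [[]|]. Qed.

Lemma twist_sub p q : (p <= q)%MS -> (twist e D p <= twist e D q)%MS.
Proof. by move=> /sub_rVP[a ->]; rewrite twistZ scalemx_sub. Qed.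

Lemma untwist_sub p q : (p <= q)%MS -> (untwist e D p <= untwist e D q)%MS.
Proof. by move=> /sub_rVP[a ->]; rewrite untwistZ scalemx_sub. Qed.

Lemma sub_twist_untwist p : (p <= twist e D (untwist e D p))%MS.
Proof. by rewrite untwistK eqmx_scale. Qed.

Lemma untwist_twist_sub p : (untwist e D (twist e D p) <= p)%MS.
Proof. by rewrite twistK scalemx_sub. Qed.

Lemma twist0 : twist e D 0 = 0.
Proof. by have := twistZ e D 0 0; rewrite !scale0r. Qed.

Lemma untwist0 : untwist e D 0 = 0.
Proof. by have := untwistZ e D 0 0; rewrite !scale0r. Qed.

Lemma twist_neq0 p : p != 0 -> twist e D p != 0.
Proof.
move=> p0; apply: contraNneq p0 => h; have := twistK e D p; rewrite h.
by rewrite untwist0 => /esym/eqP; rewrite scaler_eq0 (negPf scale_neq0).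
Qed.

Lemma untwist_neq0 p : p != 0 -> untwist e D p != 0.
Proof.
move=> p0; apply: contraNneq p0 => h; have := untwistK e D p; rewrite h.
by rewrite twist0 => /esym/eqP; rewrite scaler_eq0 (negPf scale_neq0).
Qed.

(** The last coordinate is 1 at affine points and 0 at O: it separates the two kinds and forces the
    scalar to be 1 between affine points. *)
Lemma mpoint_coords_inj (P Q : Eks) : (mc P <= mc Q)%MS -> P = Q.
Proof.
rewrite !mpoint_coordsE => /sub_rVP[a h]; apply/val_inj; move: h.
case: (val P) (val Q) => [[x y]|] [[x' y']|] //=; rewrite scale_row3 => h.
- have /rowP h' := h; have := h' (inord 2); rewrite !row3E mulr1 => a1.
  have := h' (inord 0); have := h' (inord 1); rewrite !row3E -a1 !mul1r.
  by move=> -> ->.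
- have /rowP /(_ (inord 2)) := h; rewrite !row3E mulr0 => /eqP.
  by rewrite oner_eq0.
- have /rowP h' := h; have := h' (inord 2); have := h' (inord 1).
  rewrite !row3E mulr1 => + a0; rewrite -a0 mul0r => /eqP.
  by rewrite oner_eq0.
Qed.

Fact psi_on (P : Eks) :
  mpoly_eval iota (C_t d t)
    (coords (to_proj (twist_neq0 (mpoint_coords_neq0 P)))) == 0.
Proof.
have /sub_rVP[a ->] := coords_to_proj (twist_neq0 (mpoint_coords_neq0 P)).
rewrite eval_C_t -he !mxE !inordK //= mpoint_coordsE.
have := valP P; case: (val P) => [[x y]|] /=.
  rewrite ec => /eqP e1; apply/eqP; rewrite !row3E.
  have {}e1 : y ^+ 2 = x ^+ 3 - 27 * D ^+ 2 by rewrite e1; ring.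
  by ring: e1.
by move=> _; apply/eqP; rewrite !row3E; ring.
Qed.
(** The isomorphism from E to C_t on ks-points; it involves e, hence need not be defined over k. *)
Definition psi (P : Eks) : C :=
  exist (fun Q => mpoly_eval iota (C_t d t) (coords Q) == 0) _ (psi_on P).

Lemma coords_psi P : (coords (sval (psi P)) <= twist e D (mc P))%MS.
Proof. exact: coords_to_proj. Qed.

Lemma sub_coords_psi P : (twist e D (mc P) <= coords (sval (psi P)))%MS.
Proof. exact: sub_coords_to_proj. Qed.

Lemma theta_subproof (p : C) :
  exists P : Eks, (untwist e D (coords (sval p)) <= mc P)%MS.
Proof.
have := valP p; rewrite /= eval_C_t -he.
have := untwist_neq0 (coords_neq0 (sval p)).
move: (coords (sval p)) => u u0 /eqP eu.
move: u0; rewrite /untwist.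
move: (u 0 (inord 0)) (u 0 (inord 1)) (u 0 (inord 2)) eu => X Y Z eu.
rewrite row3_eq0 => u0.
(* X - e Y is the last coordinate on E. Where it is 0 the cubic forces Z = 0, and the point
   corresponds to O; elsewhere dividing by it gives an affine point. *)
have [z0|z0] := eqVneq (X - e * Y) 0.
  exists 0; rewrite mpoint_coordsE /= z0.
  have eX : X = e * Y by apply/eqP; rewrite -subr_eq0 z0.
  have /eqP : 54 * D * e ^+ 6 * Z ^+ 3 = 0 by rewrite -[RHS]eu eX; ring.
  have n0 : 54 * D * e ^+ 6 != 0 by rewrite !mulf_neq0 ?expf_neq0.
  rewrite mulf_eq0 expf_eq0 (negPf n0) /= => /eqP ->.
  apply/sub_rVP; exists (- 9 * D * (X + e * Y)); rewrite scale_row3.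
  by rewrite !mulr0 mulr1.
have o : on_mordell Es (Some (- 18 * D * e ^+ 2 * Z / (X - e * Y),
    - 9 * D * (X + e * Y) / (X - e * Y))).
  apply/eqP; rewrite ecs.
  have eX : X ^+ 3 = e ^+ 3 * Y ^+ 3 - 54 * D * e ^+ 6 * Z ^+ 3.
    by apply/eqP; rewrite -subr_eq0; apply/eqP; rewrite -[RHS]eu; ring.
  by field: eX.
exists (Sub _ o); rewrite mpoint_coordsE /=.
apply/sub_rVP; exists (X - e * Y); rewrite scale_row3 mulr1.
by congr row3; field.
Qed.
Definition theta (p : C) : Eks := sval (cid (theta_subproof p)).

Lemma thetaP p : (untwist e D (coords (sval p)) <= mc (theta p))%MS.
Proof. exact: svalP (cid (theta_subproof p)). Qed.

Lemma coords_theta p : (coords (sval p) <= twist e D (mc (theta p)))%MS.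
Proof. exact: submx_trans (sub_twist_untwist _) (twist_sub (thetaP p)). Qed.

Lemma psiK : cancel psi theta.
Proof.
move=> P; apply/esym/mpoint_coords_inj; apply: submx_trans (thetaP _).
apply: row_sub_sym; first exact: untwist_neq0 (coords_neq0 _).
exact: submx_trans (untwist_sub (coords_psi P)) (untwist_twist_sub _).
Qed.

Lemma thetaK : cancel theta psi.
Proof.
move=> p; apply/esym/val_inj/coords_inj.
exact: submx_trans (coords_theta p) (sub_coords_psi _).
Qed.

(** Translation carried over by [psi] and its inverse [theta]. The torsor axioms are then those of
    the group E; the content lies in regularity over k. *)
Definition ct_act (p : C) (P : Eks) : C := psi (theta p + P).
Definition ct_sub (p q : C) : Eks := theta p - theta q.

Lemma ct_act0 p : ct_act p 0 = p.
Proof. by rewrite /ct_act addr0 thetaK. Qed.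
Lemma ct_actD p P Q : ct_act (ct_act p P) Q = ct_act p (P + Q).
Proof. by rewrite /ct_act psiK addrA. Qed.
Lemma ct_subK p q : ct_act p (ct_sub q p) = q.
Proof. by rewrite /ct_act /ct_sub addrC subrK thetaK. Qed.
Lemma ct_actK p P : ct_sub (ct_act p P) p = P.
Proof. by rewrite /ct_act /ct_sub psiK addrC addKr. Qed.

(** Rescaling the arguments rescales the value, so the arbitrary representatives given by [coords]
    do no harm. *)
Lemma law_sub
    (law : 'rV[ks]_3 -> 'rV[ks]_3 -> 'rV[ks]_3)
    (lawZ : forall a b p q,
      law (a *: p) (b *: q) = (a ^+ 2 * b ^+ 2) *: law p q)
    p q p' q' : (p <= p')%MS -> (q <= q')%MS -> (law p q <= law p' q')%MS.
Proof.
by move=> /sub_rVP[a ->] /sub_rVP[b ->]; rewrite lawZ scalemx_sub.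
Qed.

(** [act_law_twist] reduces the forms over k to [hess_law], and [hess_law_add] identifies the result
    with the sum. *)
Lemma act_law_sum l (P Q : Eks) :
  (act_law l D (iota t) (twist e D (mc P)) (mc Q)
     <= twist e D (mc (P + Q)))%MS.
Proof.
have [a] := act_law_twist l D e (mc P) (mc Q); rewrite he => ->.
rewrite !mpoint_coordsE.
have [b ->] := hess_law_add ecs l (valP P) (valP Q).
rewrite scalemx_sub // /twist !mxE !inordK //=.
apply/sub_rVP; exists b; rewrite scale_row3; congr row3; ring.
Qed.

Lemma sub_law_sum l (P Q : Eks) :
  (sub_law l D (iota t) (twist e D (mc P)) (twist e D (mc Q))
     <= mc (P - Q))%MS.
Proof.
have [a] := sub_law_twist l D e (mc P) (mc Q); rewrite he => ->.
rewrite scalemx_sub // !mpoint_coordsE.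
(* Negating y in (0 : 1 : 0) gives - 1 times the coordinates of O. The sign is harmless, since the
   laws are quadratic in each argument. *)
have [s s2 ->] : exists2 s, s ^+ 2 = 1 &
    neg_coords (pcoords (val Q)) = s *: pcoords (val (- Q)).
  rewrite /=; case: (val Q) => [[x y]|] /=; [exists 1|exists (- 1)];
  by rewrite ?sqrrN ?expr1n // /neg_coords !row3E scale_row3; congr row3; ring.
have [b eb] := hess_law_add ecs l (valP P) (valP (- Q)).
rewrite hess_coordsZ -[hess_coords _ (pcoords (val P))]scale1r hess_lawZ.
rewrite s2 expr1n mulr1 scale1r eb.
rewrite weier_coordsZ weier_coordsK.
by rewrite !scalemx_sub.
Qed.

Lemma on_hess_weierstrass (L : fieldType) (j : {rmorphism k -> L}) v :
  mpoly_eval j (weierstrass_form E) v = 0 ->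
  on_hess (j d) (hess_coords (j d) v).
Proof.
rewrite eval_weierstrass ec /on_hess /hess_coords !row3E => h.
(* In these coordinates u^3 + v^3 - 54 d w^3 is 54 d times the Weierstrass form. *)
rewrite -[RHS](mulr0 (54 * j d)) -h; ring.
Qed.

Lemma base_neq0 (L : fieldType) (j : {rmorphism k -> L}) :
  [/\ (2 : L) != 0, (3 : L) != 0, j d != 0 & j t != 0].
Proof.
by rewrite -[2](rmorph_nat j) -[3](rmorph_nat j) !fmorph_eq0.
Qed.

(** Around (u, v), take a law that does not vanish there. Its forms have coefficients in k, and at
    every pair of ks-points they vanish or give the translated point. *)
Lemma ct_act_regular :
  regular_over iota (C_t d t) (weierstrass_form E) sval
    (@mpoint_proj k ks iota E) sval ct_act.
Proof.
move=> L j u v u0 v0 + /on_hess_weierstrass hv; rewrite eval_C_t => hu.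
have [j2 j3 jd jt] := base_neq0 j.
have [l hl] := act_law_neq0 j2 j3 jd jt u0 v0 hu hv.
exists 2%N, 2%N, (law_forms (fun R => @act_law R l) d t); split=> [i||p P].
- by apply: act_law_bihomogeneous; do ?apply: bihomogeneousC;
    move=> i'; rewrite mxE;
    [apply: bihomogeneous_lvar|apply: bihomogeneous_rvar].
- by rewrite eval_law_forms // => *; apply: map_act_law.
rewrite eval_law_forms; last by move=> *; apply: map_act_law.
apply: submx_trans (sub_coords_psi _); apply: submx_trans (act_law_sum l _ _).
apply: law_sub; [exact: act_lawZ|exact: coords_theta|exact: coords_to_proj].
Qed.

Lemma ct_sub_regular :
  regular_over iota (C_t d t) (C_t d t) sval sval
    (@mpoint_proj k ks iota E) ct_sub.
Proof.
move=> L j u v u0 v0; rewrite !eval_C_t => hu hv.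
have [j2 j3 jd jt] := base_neq0 j.
have [l hl] := sub_law_neq0 j2 j3 jd jt u0 v0 hu hv.
exists 2%N, 2%N, (law_forms (fun R => @sub_law R l) d t); split=> [i||p q].
- by apply: sub_law_bihomogeneous; do ?apply: bihomogeneousC;
    move=> i'; rewrite mxE;
    [apply: bihomogeneous_lvar|apply: bihomogeneous_rvar].
- by rewrite eval_law_forms // => *; apply: map_sub_law.
rewrite eval_law_forms; last by move=> *; apply: map_sub_law.
apply: submx_trans (sub_coords_to_proj _).
apply: submx_trans (sub_law_sum l _ _).
apply: law_sub; [exact: sub_lawZ|exact: coords_theta|exact: coords_theta].
Qed.

Definition ct_phs : phs iota E (C_t d t) :=
  PHS ct_act0 ct_actD ct_subK ct_actK ct_act_regular ct_sub_regular.

End Torsor.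

(** * The cocycle at the image of O *)

Section KummerCocycle.
Variables (k ks : fieldType) (iota : {rmorphism k -> ks}) (E : mordell k).
Variables (d t : k) (e w r : ks).
Hypotheses (t0 : t != 0) (he : e ^+ 3 = iota t).
Hypothesis ec : mcoef E = - 27 * d ^+ 2.
Hypothesis hr : r ^+ 2 = iota (mcoef E).
Hypotheses (hw : 3.-primitive_root w) (hd : r = 3 * (2 * w + 1) * iota d).
Local Notation D := (iota d).

Lemma coords_gal_proj n (s : galois iota) (P : proj ks n) :
  (coords (gal_proj s P) <= map_mx s (coords P))%MS.
Proof. exact: coords_to_proj. Qed.

(** [psi] sends O, (0, r), (0, - r) to (e : 1 : 0), (w e : 1 : 0), (w^2 e : 1 : 0), the points of
    C_t with Z = 0. The automorphism s takes the first to (s e : 1 : 0), and the definition of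
    [kummer_fun] matches the three cases. *)
Lemma kummer_psi0 (s : galois iota) :
  gal_proj s (sval (psi ec t0 he 0)) =
  sval (psi ec t0 he (val (kummer_fun hr w e s))).
Proof.
have d0 : D != 0.
  rewrite fmorph_eq0; have := mcoef_neq0 E; rewrite ec.
  by apply: contraNneq => ->; rewrite expr0n mulr0.
have n18 : (18 : ks) != 0.
  have n2 : (2 : k) != 0 by have := mordell_pchar2 E; rewrite inE.
  have n3 : (3 : k) != 0 by have := mordell_pchar3 E; rewrite inE.
  rewrite -[18](rmorph_nat iota) fmorph_eq0.
  by rewrite (_ : 18 = 2 * 3 ^+ 2) ?mulf_neq0 ?expf_neq0 //; ring.
have w1 : w != 1.
  by rewrite -[w]expr1 -(prim_order_dvd hw).
have w2 : w ^+ 2 = - w - 1.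
  have w10 : w - 1 != 0 by rewrite subr_eq0.
  apply/(mulfI w10)/eqP; rewrite -subr_eq0; apply/eqP.
  transitivity (w ^+ 3 - 1); first by ring.
  by rewrite (prim_expr_order hw) subrr.
apply/coords_inj; apply: submx_trans (sub_coords_psi _ _ _ _).
apply: submx_trans (coords_gal_proj _ _) _.
have /sub_rVP[a ->] := coords_psi ec t0 he 0.
rewrite map_mxZ scalemx_sub // map_row3 !mpoint_coordsE /kummer_fun.
rewrite /twist /hess_coords !row3E !(rmorphM, rmorphN, rmorphXn, rmorph0) /=.
have [-> | ne1] := eqVneq (s e) e.
  rewrite !row3E !(rmorphB, rmorphD, rmorphM, rmorph0, rmorph1, rmorph_nat).
  by rewrite gal_fix.
have [-> | ne2] := eqVneq (s e) (w * e).
  (* As 9 d - r = 6 d (1 - w), the scalar is - w^2 / (6 d (1 - w)); it takes this form because (1 -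
     w)^2 = - 3 w. *)
  apply/sub_rVP; exists (w * (1 - w) / (18 * D)); rewrite scale_row3 /= !row3E.
  rewrite !(rmorphB, rmorphD, rmorphM, rmorph0, rmorph1, rmorph_nat) hd.
  congr row3; field: w2; by rewrite ?d0 ?n18.
have -> : s e = w ^+ 2 * e.
  have /eqP : (s e - e) * ((s e - w * e) * (s e - w ^+ 2 * e)) = 0.
    have se3 : s e ^+ 3 = e ^+ 3 by rewrite -rmorphXn he /= gal_fix.
    by rewrite w2; ring: w2 se3.
  rewrite !mulf_eq0 !subr_eq0 (negPf ne1) (negPf ne2).
  by move=> /eqP.
(* As 9 d + r = 6 d (2 + w), the scalar is - w / (6 d (2 + w)), and (2 + w)^2 = - 3 w^2. *)
apply/sub_rVP; exists (w ^+ 2 * (2 + w) / (18 * D)).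
rewrite scale_row3 /= !row3E.
rewrite !(rmorphB, rmorphD, rmorphM, rmorph0, rmorph1, rmorph_nat) hd.
congr row3; field: w2; by rewrite ?d0 ?n18.
Qed.
End KummerCocycle.

Theorem proposition2p1 (k ks : fieldType) (iota : {rmorphism k -> ks})
    (hks : is_separable_closure iota)
    (h2 : (2 \notin [pchar k])%N) (h3 : (3 \notin [pchar k])%N)
    (c : k) (hc : c != 0)
    (d : k) (hd : d ^+ 2 = - c / 27)
    (r : ks) (hr : r ^+ 2 = iota c)
    (w : ks) (hw : 3.-primitive_root w)
    (hrd : r = 3 * (2 * w + 1) * iota d)
    (t : k) (ht0 : t != 0) (ht : forall u : k, u ^+ 3 != t)
    (e : ks) (he : e ^+ 3 = iota t) :
  let E := Mordell hc h2 h3 in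
  let Psi := H1_map (torsion_incl (iota := iota) (E := E) hr) in
  let gamma_t := kummer_cocycle (E := E) hr hw hrd ht0 he in
  curve_of_class (C_t d t) (Psi (H1_class gamma_t)).
Proof.
move=> E Psi gamma_t.
have n2 : (2 : k) != 0 by have := h2; rewrite inE.
have n3 : (3 : k) != 0 by have := h3; rewrite inE.
have n27 : (27 : k) != 0 by rewrite (_ : 27 = 3 ^+ 3) ?expf_neq0 //; ring.
have ec : mcoef E = - 27 * d ^+ 2 by rewrite hd /=; field.
have d0 : d != 0.
  by move: (hc); apply: contra_neq => d0; move: ec; rewrite d0 expr0n mulr0.
split; first exact: smooth_C_t.
(* At the base point [psi] of O, the cocycle is the image of [gamma_t] on the nose, with no
   coboundary to correct. *)
exists (ct_phs ec ht0 he), (psi ec ht0 he 0), 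
  (cocycle_map (torsion_incl (E := E) hr) gamma_t).
split; last by rewrite /Psi H1_mapE.
move=> s; rewrite (kummer_psi0 ht0 he ec (E := E) hr hw hrd).
by rewrite /= /ct_act psiK add0r.
Qed.
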